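(* Let $V$ be a finite dimensional complex vector space, $\Lambda\subset V$ a maximal lattice, $\tau:V\to V$ an anti-linear involution with $\tau(\Lambda)\subset\Lambda$, and denote also by $\tau$ the induced involution on $T:=V/\Lambda$. Let $(H,\alpha)$ be an Appell-Humbert datum for $(V,\Lambda)$ and put $\mathcal{L}:=\mathcal{L}(H,\alpha)$. If $[\mathcal{L}]\in\mathrm{Pic}(T)$ is $\hat\tau$-invariant, then: 1. $w(\mathcal{L})([\mu])=w(\mathcal{L})([0])+\overline{\mathrm{Im}\,H(2\mu,\cdot)}$ for every $\mu\in\frac12\Lambda^{-\tau}$; 2. $w(\mathcal{L})([\mu])(\lambda+\tau\lambda)=\overline{\mathrm{Im}\,H(\lambda,\tau\lambda)}$ for every $\lambda\in\Lambda$ and every $\mu\in\frac12\Lambda^{-\tau}$; 3. $w(\mathcal{L})([0])(\lambda)=\bar\alpha(\lambda)$ for every $\lambda\in\Lambda^\tau$. Here the bar on the right hand side denotes congruence class mod 2 in 1 and 2, and complex conjugation in 3 (where $\mathbb{Z}_2$ is identified with $\{\pm1\}\subset S^1$).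
   Context: Notation: $\Lambda^{\tau}=\{\lambda\in\Lambda\mid\tau\lambda=\lambda\}$, $\Lambda^{-\tau}=\{\lambda\in\Lambda\mid\tau\lambda=-\lambda\}$, $V^\tau$ is the fixed subspace. An Appell-Humbert datum for $(V,\Lambda)$ is a pair $(H,\alpha)$, where $H:V\times V\to\mathbb{C}$ is a Hermitian form (convention: anti-linear in the first and complex linear in the second argument) with $(\mathrm{Im}\,H)(\Lambda\times\Lambda)\subset\mathbb{Z}$, and $\alpha:\Lambda\to S^1$ is an $\mathrm{Im}\,H$-semi-character, i.e. $\alpha(\lambda+\lambda')=\alpha(\lambda)\alpha(\lambda')e^{\pi i\,\mathrm{Im}H(\lambda,\lambda')}$. It defines the factor of automorphy $a(H,\alpha):\Lambda\times V\to\mathbb{C}^*$, $a(H,\alpha)(\lambda,v):=\alpha(\lambda)e^{\pi[H(\lambda,v)+\frac12H(\lambda,\lambda)]}$, and the holomorphic line bundle $\mathcal{L}(H,\alpha):=(V\times\mathbb{C})/\sim$ on $T$, where $(v,z)\sim(v+\lambda,a(H,\alpha)(\lambda,v)z)$ for $\lambda\in\Lambda$. The involution $\hat\tau:\mathrm{Pic}(T)\to\mathrm{Pic}(T)$ is $\hat\tau([\mathcal{L}]):=[\tau^*(\bar{\mathcal{L}})]$. If $\hat\tau[\mathcal{L}]=[\mathcal{L}]$, there is an involutive anti-holomorphic (fibrewise anti-linear) lift $\tilde\tau_{\mathcal{L}}:\mathcal{L}\to\mathcal{L}$ of $\tau$, unique up to multiplication by constants in $S^1$; its fixed point locus is a real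 line bundle $\mathcal{L}^{\tilde\tau_{\mathcal{L}}}$ over $T^\tau$, and $w(\mathcal{L}):=w_1(\mathcal{L}^{\tilde\tau_{\mathcal{L}}})\in H^1(T^\tau,\mathbb{Z}_2)$. The fixed point locus decomposes as the disjoint union $$T^\tau=\coprod_{[\mu]\in\frac12\Lambda^{-\tau}/\frac12(1-\tau)\Lambda}\left(V^\tau/\Lambda^\tau+[\mu]\right).$$ Each component is a translate of $V^\tau/\Lambda^\tau$, so its $H^1(\cdot,\mathbb{Z}_2)$ is $\mathrm{Hom}(\Lambda^\tau,\mathbb{Z}_2)$ ($\lambda\in\Lambda^\tau$ corresponding to the loop $t\mapsto[\mu+t\lambda]$, $t\in[0,1]$). Thus $w(\mathcal{L})$ is regarded as a map $$w(\mathcal{L}):\tfrac12\Lambda^{-\tau}/\tfrac12(1-\tau)\Lambda\to\mathrm{Hom}(\Lambda^\tau,\mathbb{Z}_2),$$ whose value at $[\mu]$ is the restriction of $w(\mathcal{L})$ to the component $V^\tau/\Lambda^\tau+[\mu]$. *)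

(* Defs.v *)
From HB Require Import structures.
From mathcomp Require Import all_boot all_order all_algebra.
From mathcomp Require Import all_classical all_reals all_analysis.
From mathcomp Require Import complex.
From mathcomp Require Import ring.

Set Implicit Arguments.
Unset Strict Implicit.
Unset Printing Implicit Defensive.

Import Order.TTheory GRing.Theory Num.Theory.
Import numFieldNormedType.Exports.

Local Open Scope classical_set_scope.
Local Open Scope ring_scope.
Local Open Scope complex_scope.
Local Open Scope quotient_scope.

(* R[i]^o is R[i] as a normed space over itself; [differentiable] between normed
   R[i]-modules is complex Frechet differentiability, so that holomorphic on an
   open set means [differentiable] at each of its points. *)

(* [normed V] is V with the l^1-norm of the coordinates of a fixed basis; its
   topology is the usual one and does not depend on the basis. *)
Definition normed (R : realType) (V : vectType R[i]) : Type := V.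

Section Normed.
Variables (R : realType) (V : vectType R[i]).

HB.instance Definition _ := GRing.Lmodule.copy (normed V) V.
HB.instance Definition _ := Vector.copy (normed V) V.

Definition coord_norm (x : normed V) : R[i] := 
  \sum_i `|coord (vbasis {:V}) i (x : V)|.

Lemma coord_normD x y : coord_norm (x + y) <= coord_norm x + coord_norm y.
Proof.
rewrite /coord_norm -big_split /=; apply: ler_sum => i _.
by rewrite linearD ler_normD.
Qed.

Lemma coord_normZ (c : R[i]) x : coord_norm (c *: x) = `|c| * coord_norm x.
Proof.
rewrite /coord_norm mulr_sumr; apply: eq_bigr => i _.
by rewrite linearZ normrM.
Qed.

Lemma coord_norm0_eq0 x : coord_norm x = 0 -> x = 0.
Proof.
move=> /eqP; rewrite psumr_eq0 // => /allP h.
rewrite (coord_vbasis (memvf (x : V))); apply: big1 => i _.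
by have /implyP/(_ isT) := h i (mem_index_enum i); rewrite normr_eq0 => /eqP ->; rewrite scale0r.
Qed.

HB.instance Definition _ := @Lmodule_isNormed.Build R[i] (normed V)
  coord_norm coord_normD coord_normZ coord_norm0_eq0.

End Normed.

Section Torus.
Variables (R : realType) (V : vectType R[i]) (Lam : zmodClosed V).

(* a discrete subgroup of V spanning V over the reals *)
Definition maximal_lattice : Prop :=
  (exists2 U : set (normed V), open_nbhs 0 U &
     forall l : V, l \in Lam -> U l -> l = 0) /\
  (forall v : V, exists (n : nat) (t : 'I_n -> R) (l : 'I_n -> V),
     (forall i, l i \in Lam) /\ v = \sum_i (t i)%:C *: l i).

Definition lat_rel : rel (normed V) := fun x y => (x : V) - y \in Lam.

Lemma lat_rel_equiv : equiv_class_of lat_rel.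
Proof.
split=> [x|x y|y x z]; rewrite /lat_rel.
- by rewrite subrr rpred0.
- by rewrite -opprB rpredN.
- by move=> xy yz; rewrite -(subrKA (y : V)) rpredD.
Qed.

Canonical lat_rel_equivRel := EquivRelPack lat_rel_equiv.

Definition torus : Type := quotient_topology {eq_quot lat_rel}.
HB.instance Definition _ := Topological.on torus.
HB.instance Definition _ := Quotient.on torus.

Definition antilinear (tau : V -> V) : Prop :=
  (forall u v, tau (u + v) = tau u + tau v) /\
  (forall (c : R[i]) v, tau (c *: v) = c^* *: tau v).

(* the involution induced on T (meaningful when tau is additive and maps Lam to
   itself) *)
Definition torus_map (tau : V -> V) (x : torus) : torus :=
  \pi_torus (tau (repr x) : normed V).

Lemma torus_piP (x y : normed V) :
  reflect (\pi_torus x = \pi_torus y) ((x : V) - y \in Lam).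
Proof. exact: (@eqquotP _ _ {eq_quot lat_rel} x y). Qed.

Lemma torus_map_pi (tau : V -> V) (v : normed V) :
  antilinear tau -> {in Lam, forall l, tau l \in Lam} ->
  torus_map tau (\pi_torus v) = \pi_torus (tau v : normed V).
Proof.
move=> [tauD tauZ] tauL; apply/torus_piP.
have tauN u : tau (- u) = - tau u.
  by rewrite -scaleN1r tauZ rmorphN1 scaleN1r.
rewrite -tauN -tauD; apply: tauL; apply/torus_piP.
by rewrite reprK.
Qed.

Definition torus_loop (mu lam : V) (t : R) : torus :=
  \pi_torus (mu + t%:C *: lam : normed V).

End Torus.

Section LineBundle.
Variables (R : realType) (X : Type).

(* The data of a holomorphic line bundle over X: the total space, as a
   topological space with a sheaf of holomorphic functions ([lb_holo U f] reads:
   U is open and f is holomorphic on U, the values of f off U being irrelevant),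
   the projection, and the scalar multiplication on the fibres.  The fibres being
   lines, their addition is determined by the scalar multiplication, and a
   fibrewise map commuting with scalars is fibrewise linear. *)
Record line_bundle : Type := LineBundle {
  lb_total :> topologicalType;
  lb_holo : set lb_total -> (lb_total -> R[i]) -> Prop;
  lb_proj : lb_total -> X;
  lb_scale : R[i] -> lb_total -> lb_total
}.

Definition holomorphic_map (E F : line_bundle) (phi : E -> F) : Prop :=
  continuous phi /\
  forall U f, @lb_holo F U f -> @lb_holo E (phi @^-1` U) (f \o phi).

Definition conj_bundle (E : line_bundle) : line_bundle :=
  @LineBundle E (fun U f => @lb_holo E U (conjc \o f))
    (@lb_proj E) (fun c e => lb_scale c^* e).

(* The pull-back s^* E along an involution s of X: the second projection
   identifies the fibre product {(x, e) | s x = p e} with the total space of E,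
   and then the first projection becomes s \o p. *)
Definition pullback_invol (s : X -> X) (E : line_bundle) : line_bundle :=
  @LineBundle E (@lb_holo E) (s \o @lb_proj E) (@lb_scale E).

(* equality of the classes in Pic(X): there is a biholomorphic fibrewise linear
   map covering the identity of X *)
Definition pic_eq (E F : line_bundle) : Prop :=
  exists (phi : E -> F) (psi : F -> E),
    [/\ cancel phi psi, cancel psi phi, holomorphic_map phi, holomorphic_map psi &
     (forall e, lb_proj (phi e) = lb_proj e) /\
     (forall c e, phi (lb_scale c e) = lb_scale c (phi e))].

(* the involution L |-> s^* (conjugate of L), on line bundles *)
Definition hat (s : X -> X) (E : line_bundle) : line_bundle :=
  pullback_invol s (conj_bundle E).

(* the involutive anti-holomorphic, fibrewise anti-linear lifts of s; a map to E
   is anti-holomorphic iff it is holomorphic as a map to the conjugate of E *)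
Definition real_lift (s : X -> X) (E : line_bundle) (sigma : E -> E) : Prop :=
  [/\ involutive sigma,
      @holomorphic_map E (conj_bundle E) sigma,
      forall e, lb_proj (sigma e) = s (lb_proj e) &
      forall c e, sigma (lb_scale c e) = lb_scale c^* (sigma e)].

(* The value of w_1 of the real line bundle E^sigma (the fixed locus of sigma) on
   a loop gamma : [0, 1] -> X^s.  By naturality it is w_1 of the pull-back of
   E^sigma to the circle [0, 1]/{0, 1}, which vanishes iff this pull-back is
   trivial, i.e. has a continuous nowhere zero section.  The zero of the fibre
   through e is [lb_scale 0 e]. *)
Definition w1_loop (E : line_bundle) (sigma : E -> E) (gamma : R -> X) : 'Z_2 :=
  if `[< exists s : R -> E,
         [/\ {within `[0, 1], continuous s}, s 0 = s 1 &
          forall t, 0 <= t <= 1 ->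
            [/\ lb_proj (s t) = gamma t, sigma (s t) = s t &
                s t <> lb_scale 0 (s t)]] >]
  then 0 else 1.

(* a lift as in [real_lift] (all choices differ by constants in S^1) *)
Definition chosen_lift (s : X -> X) (E : line_bundle) : E -> E :=
  match pselect (exists sigma, @real_lift s E sigma) with
  | left h => projT1 (cid h)
  | right _ => id
  end.

End LineBundle.

Section AppellHumbert.
Variables (R : realType) (V : vectType R[i]) (Lam : zmodClosed V).

Definition cexp (z : R[i]) : R[i] :=
  (expR (complex.Re z))%:C * (cos (complex.Im z) +i* sin (complex.Im z)).

Lemma cexpD x y : cexp (x + y) = cexp x * cexp y.
Proof.
case: x => a b; case: y => c d; rewrite /cexp /= expRD cosD sinD.
by apply/eqP; rewrite eq_complex /=; apply/andP; split; apply/eqP; ring.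
Qed.

Lemma cexp0 : cexp 0 = 1.
Proof. by rewrite /cexp /= expR0 cos0 sin0 mul1r. Qed.

(* [AH_char] is only relevant on Lam.  Hermitian forms are anti-linear in the
   first argument, which follows from [AH_formZr] and [AH_formJ]. *)
Record AH_datum : Type := AHDatum {
  AH_form : V -> V -> R[i];
  AH_char : V -> R[i];
  AH_formDr : forall u v w, AH_form u (v + w) = AH_form u v + AH_form u w;
  AH_formZr : forall u c v, AH_form u (c *: v) = c * AH_form u v;
  AH_formJ : forall u v, AH_form v u = (AH_form u v)^*;
  AH_form_int : {in Lam &, forall l l', complex.Im (AH_form l l') \is a Num.int};
  AH_char_norm : {in Lam, forall l, `|AH_char l| = 1};
  AH_charD : {in Lam &, forall l l', AH_char (l + l') =
    AH_char l * AH_char l' * cexp ('i * (pi * complex.Im (AH_form l l'))%:C)}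
}.

Variable D : AH_datum.

Definition AH_factor (l v : V) : R[i] :=
  AH_char D l * cexp (pi%:C * (AH_form D l v + 2^-1 * AH_form D l l)).

Lemma AH_formDl u v w : AH_form D (u + v) w = AH_form D u w + AH_form D v w.
Proof.
by rewrite (AH_formJ D w (u + v)) AH_formDr rmorphD /= -(AH_formJ D w u) -(AH_formJ D w v).
Qed.

Lemma AH_form0l v : AH_form D 0 v = 0.
Proof. by apply: (addrI (AH_form D 0 v)); rewrite -AH_formDl !addr0. Qed.

Lemma AH_factor0 v : AH_factor 0 v = 1.
Proof.
have L0 : 0 \in Lam by exact: rpred0.
rewrite /AH_factor !AH_form0l mulr0 addr0 mulr0 cexp0 mulr1.
have := AH_charD D L0 L0.
rewrite addr0 AH_form0l mulr0 mulr0 cexp0 mulr1 => /esym/eqP.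
have a0 : AH_char D 0 != 0 by rewrite -normr_eq0 AH_char_norm // oner_eq0.
by rewrite -[X in _ == X]mulr1 => /eqP/(mulfI a0).
Qed.

Lemma AH_factorD l l' v : l \in Lam -> l' \in Lam ->
  AH_factor (l + l') v = AH_factor l (v + l') * AH_factor l' v.
Proof.
move=> Ll Ll'; rewrite /AH_factor AH_charD // -[LHS]mulrA [RHS]mulrACA; congr (_ * _).
rewrite -!cexpD; congr cexp.
rewrite !(AH_formDl, AH_formDr) (AH_formJ D l l').
set b := complex.Im _; set z := AH_form D l l'.
have zb : z - z^* = 2 * (b%:C * 'i) :> R[i] by rewrite subcJ mulrA.
have -> : z^* = z - 2 * (b%:C * 'i) :> R[i] by rewrite -zb; ring.
by rewrite rmorphM /=; field.
Qed.

Definition AH_rel : rel (normed V * R[i]^o) := fun p q =>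
  `[< exists2 l : V, l \in Lam &
      q = ((p.1 : V) + l, AH_factor l p.1 * p.2) >].

Lemma AH_rel_equiv : equiv_class_of AH_rel.
Proof.
have sym p q : AH_rel p q -> AH_rel q p.
  case: p => v z; move=> /asboolP[l Ll ->] /=; apply/asboolP.
  exists (- l) => /=; first by rewrite rpredN.
  by rewrite addrK mulrA -AH_factorD ?rpredN // addNr AH_factor0 mul1r.
split=> [[v z]|p q|q p r].
- by apply/asboolP; exists 0; rewrite ?rpred0 //= addr0 AH_factor0 mul1r.
- by apply/idP/idP; apply: sym.
- case: p => v z /asboolP[l Ll ->] /asboolP[l' Ll' ->] /=; apply/asboolP.
  exists (l' + l); first by rewrite rpredD.
  by rewrite /= AH_factorD // mulrA (addrC l') addrA.
Qed.

Canonical AH_rel_equivRel := EquivRelPack AH_rel_equiv.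

Definition AH_total : Type := quotient_topology {eq_quot AH_rel}.
HB.instance Definition _ := Topological.on AH_total.
HB.instance Definition _ := Quotient.on AH_total.

Definition AH_proj (e : AH_total) : torus Lam := \pi_(torus Lam) (repr e).1.

Definition AH_scale (c : R[i]) (e : AH_total) : AH_total :=
  \pi_AH_total ((repr e).1, c * (repr e).2).

(* the complex structure making V x C -> (V x C) / ~ locally biholomorphic *)
Definition AH_holo (U : set AH_total) (f : AH_total -> R[i]) : Prop :=
  open U /\
  forall p : normed V * R[i]^o, U (\pi_AH_total p) ->
    differentiable (f \o \pi_AH_total : normed V * R[i]^o -> R[i]^o) p.

Definition AH_bundle : line_bundle R (torus Lam) :=
  LineBundle AH_holo AH_proj AH_scale.

Lemma AH_piP (p q : normed V * R[i]^o) :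
  reflect (\pi_AH_total p = \pi_AH_total q)
          `[< exists2 l : V, l \in Lam & q = ((p.1 : V) + l, AH_factor l p.1 * p.2) >].
Proof. exact: (@eqquotP _ _ {eq_quot AH_rel} p q). Qed.

Lemma AH_proj_pi p : AH_proj (\pi_AH_total p) = \pi_(torus Lam) p.1.
Proof.
have /AH_piP/asboolP[l Ll e] : \pi_AH_total (repr (\pi_AH_total p)) = \pi_AH_total p.
  by rewrite reprK.
rewrite /AH_proj {2}e; apply/torus_piP => /=.
by rewrite opprD addNKr rpredN.
Qed.

Lemma AH_scale_pi c p : AH_scale c (\pi_AH_total p) = \pi_AH_total (p.1, c * p.2).
Proof.
have /AH_piP/asboolP[l Ll e] : \pi_AH_total (repr (\pi_AH_total p)) = \pi_AH_total p.
  by rewrite reprK.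
rewrite /AH_scale {3 4}e; apply/AH_piP/asboolP; exists l => //=.
by rewrite mulrCA.
Qed.

End AppellHumbert.

Section Class.
Variables (R : realType) (V : vectType R[i]) (Lam : zmodClosed V).
Variables (tau : V -> V) (E : line_bundle R (torus Lam)).

Definition tau_invariant : Prop := pic_eq (hat (torus_map tau) E) E.

(* [half_anti mu]: mu lies in (1/2) Lam^(-tau) *)
Definition half_anti (mu : V) : Prop :=
  mu *+ 2 \in Lam /\ tau (mu *+ 2) = - (mu *+ 2).

(* w(E)([mu])(lam), for mu in (1/2) Lam^(-tau) and lam in Lam^tau: the value of
   w_1(E^sigma) on the loop t |-> [mu + t lam] of T^tau *)
Definition w_class (mu lam : V) : 'Z_2 :=
  w1_loop (@chosen_lift R _ (torus_map tau) E) (torus_loop Lam mu lam).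

End Class.

(* meant for x integral *)
Definition mod2 (R : realType) (x : R) : 'Z_2 := (Num.floor x)%:~R.

(* the identification of Z_2 with {1, -1} *)
Definition sign_of (R : realType) (b : 'Z_2) : R[i] := (-1) ^+ (b : nat).

(* Main.v *)
Require Import Defs.
From HB Require Import structures.
From mathcomp Require Import all_boot all_order all_algebra.
From mathcomp Require Import all_classical all_reals all_analysis.
From mathcomp Require Import complex.
From mathcomp Require Import ring lra.
Set Implicit Arguments.
Unset Strict Implicit.
Unset Printing Implicit Defensive.
Import Order.TTheory GRing.Theory Num.Theory.
Import numFieldNormedType.Exports.
Local Open Scope classical_set_scope.
Local Open Scope ring_scope.
Local Open Scope complex_scope.
Local Open Scope quotient_scope.

(** A lift [phi] of the involution to the line bundle has the form
    [phi [v, z] = [tau v, g v * conj z]], and compatibility with the lattice says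
    that [conj g] is a nowhere zero section of the line bundle whose Hermitian form
    is [B(u, v) = conj H(tau u, tau v) - H(u, v)].  The norm of such a section for
    the metric [exp (- pi B(v, v))] is a continuous function on the compact torus.
    At a point where it is maximal, the maximum principle along complex lines
    shows that [B] is positive semi-definite; the inverse of the section shows that
    it is negative semi-definite.  So [B = 0], the section is constant, and
    [H(tau u, tau v) = conj H(u, v)], [alpha o tau = conj alpha] and
    [phi [v, z] = [tau v, k * conj z]] with a constant [k]
    ([nonvanishing_section], [antiholo_lift_form]).  Rescaling [phi] so that [k = 1]
    gives an involution, which proves that real lifts exist ([real_lift_exists]).

    The class is then read off from the monodromy of one real line.  Along the loop
    [p t = mu + t lam], with [tau mu = - mu] and [tau lam = lam], one has
    [tau (p t) = p t - 2 mu]; going back by the factor of automorphy of [2 mu], the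
    lift acts on the fibre coordinate by [z |-> e(t)^2 conj z], where
    [e(t) = rho exp (i pi t m / 2)] has modulus one and [m = Im H(2 mu, lam)] is an
    integer.  The fixed real line is therefore spanned by [e(t)].  Comparing [e(1)]
    with [e(0)] through the factor of automorphy of [lam], a positive real number
    times [alpha(lam) exp (- i pi m / 2)], shows that a continuous real section is
    multiplied by a number of the sign of [alpha(lam) (-1)^m] around the loop, and
    the intermediate value theorem turns this into
    [(-1)^(w [mu] lam) = alpha(lam) (-1)^m] ([w1_loop_sign]).  The three assertions
    are instances of this formula.

    The maximum principle is proved for maps that are complex differentiable at
    each point, without assuming that the derivative is continuous.  Pulled back by
    the exponential, a function on the punctured plane becomes periodic on
    rectangles, where Goursat's bisection applies ([mixed_difference_eq0]); the
    integral over a period is then the same on all circles about the origin, and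
    its limit at the origin gives the mean value property
    ([max_principle_cylinder], [max_modulus]). *)

(** * Closed forms on rectangles *)

Section RealAnalysis.
Variable R : realType.
Implicit Types (a b c d e x y : R).

Lemma antiderivative (f : R -> R) a : continuous f ->
  exists F : R -> R, forall x, a < x -> is_derive x 1 F (f x).
Proof.
move=> cf.
exists (fun x => \int[lebesgue_measure]_(t in [set` `[a, x]]) (f t))%R => x ax.
have xu : x < x + 1 by rewrite ltrDl.
have fi : lebesgue_measure.-integrable `[a, x + 1] (EFin \o f).
  apply: continuous_compact_integrable; first exact: segment_compact.
  by apply: continuous_subspaceT => y; exact: cf.
have [dF <-] := continuous_FTC1_closed xu fi ax (cf x).
by rewrite derive1E; apply: DeriveDef.
Qed.

Lemma increment_bound (F f : R -> R) (k e a b : R) : a <= b ->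
  (forall x, a <= x <= b -> is_derive x 1 F (f x)) ->
  (forall x, a <= x <= b -> `|f x - k| <= e) ->
  `|F b - F a - k * (b - a)| <= e * (b - a).
Proof.
move=> ab dF fk.
have [c /[!in_itv]/= cab ->] : exists2 c, c \in `[a, b]%R &
    F b - F a = f c * (b - a).
  apply: (@MVT_segment R F f) => // [x /[!in_itv]/= /andP[ax xb]|].
    by apply: dF; rewrite !ltW.
  apply: derivable_within_continuous => x; rewrite in_itv/= => xab.
  by have [] := dF x xab.
rewrite -mulrBl normrM (ger0_norm (_ : 0 <= b - a)) ?subr_ge0//.
by rewrite ler_wpM2r ?subr_ge0 ?fk.
Qed.

Lemma nested_intervals (p l : nat -> R) :
  (forall n, 0 <= l n) -> (forall n, p n <= p n.+1) ->
  (forall n, p n.+1 + l n.+1 <= p n + l n) ->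
  exists x, forall n, p n <= x <= p n + l n.
Proof.
move=> l0 pS plS.
have pmon : {homo p : m n / (m <= n)%N >-> m <= n}.
  by apply: homo_leq => // y x z; exact: le_trans.
have plmon m n : (m <= n)%N -> p n + l n <= p m + l m.
  move=> /subnK<-; elim: (n - m)%N => [//|k ih].
  by rewrite addSn; exact: le_trans (plS _) ih.
have ub m n : p n <= p m + l m.
  have [mn|/ltnW nm] := leqP m n.
    by apply: le_trans (plmon _ _ mn); rewrite lerDl.
  by apply: le_trans (pmon _ _ nm) _; rewrite lerDl.
have hs : has_sup (range p).
  by split; [exists (p 0%N), 0%N | exists (p 0%N + l 0%N) => _ [n _ <-]; exact: ub].
exists (sup (range p)) => n; apply/andP; split.
  by apply: sup_upper_bound => //; exists n.
by apply: ge_sup; [exact: hs.1 | move=> _ [m _ <-]; exact: ub].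
Qed.

(** The integral of a differential form over the boundary of a rectangle, written
    through antiderivatives [Z] of its coefficients; in this form additivity under
    subdivision is a polynomial identity. *)
Definition mixed_difference (Z : R -> R -> R) a b c d :=
  Z b d - Z b c - Z a d + Z a c.

(** Goursat's argument: bisect the rectangle, keeping a quarter with at least a
    quarter of the mixed difference.  After [n] steps the value is at least [4^-n]
    times the initial one, while at the common point of the nested rectangles the
    hypothesis bounds it by [e 4^-n] times a constant, for every [e]. *)
Lemma mixed_difference_eq0 (Z : R -> R -> R) a b c d : a <= b -> c <= d ->
  (forall x y, a <= x <= b -> c <= y <= d -> forall e, 0 < e ->
     exists2 r, 0 < r & forall a' b' c' d',
       [/\ a <= a', a' <= x <= b' & b' <= b] ->
       [/\ c <= c', c' <= y <= d' & d' <= d] -> b' - a' < r -> d' - c' < r ->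
       `|mixed_difference Z a' b' c' d'| <= e * (b' - a' + (d' - c')) ^+ 2) ->
  mixed_difference Z a b c d = 0.
Proof.
move=> ab cd loc.
set s := b - a; set t := d - c.
have s0 : 0 <= s by rewrite subr_ge0.
have t0 : 0 <= t by rewrite subr_ge0.
(* [r] is the lower left corner of a rectangle with sides [s / 2^n], [t / 2^n] *)
pose J n (r : R * R) :=
  mixed_difference Z r.1 (r.1 + s / 2 ^+ n) r.2 (r.2 + t / 2 ^+ n).
have half (u : R) n : u / 2 ^+ n = u / 2 ^+ n.+1 + u / 2 ^+ n.+1.
  by rewrite exprSr; field; rewrite expf_eq0 /= pnatr_eq0 andbF.
pose P n (r r' : R * R) := [/\ r.1 <= r'.1, r'.1 + s / 2 ^+ n.+1 <= r.1 + s / 2 ^+ n,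
   r.2 <= r'.2 , r'.2 + t / 2 ^+ n.+1 <= r.2 + t / 2 ^+ n
   & `|J n r| <= 4 * `|J n.+1 r'|].
have sn0 n : 0 <= s / 2 ^+ n by rewrite divr_ge0// exprn_ge0.
have tn0 n : 0 <= t / 2 ^+ n by rewrite divr_ge0// exprn_ge0.
have step n r : exists r', P n r r'.
  case: r => p q; rewrite /P /J (half s n) (half t n) /=.
  set h := s / 2 ^+ n.+1; set k := t / 2 ^+ n.+1.
  have h0 : 0 <= h by exact: sn0.
  have k0 : 0 <= k by exact: tn0.
  set j1 := mixed_difference Z p (p + h) q (q + k).
  set j2 := mixed_difference Z (p + h) (p + h + h) q (q + k).
  set j3 := mixed_difference Z p (p + h) (q + k) (q + k + k).
  set j4 := mixed_difference Z (p + h) (p + h + h) (q + k) (q + k + k).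
  have -> : mixed_difference Z p (p + (h + h)) q (q + (k + k)) = j1 + j2 + j3 + j4.
    by rewrite /j1 /j2 /j3 /j4 /mixed_difference !addrA; ring.
  set j := _ + j4.
  have tri : `|j| <= `|j1| + `|j2| + `|j3| + `|j4|.
    by rewrite /j (le_trans (ler_normD _ _))// lerD2r (le_trans (ler_normD _ _))// lerD2r ler_normD.
  have [h1|h1] := leP `|j| (4 * `|j1|); first by exists (p, q); split => //=; lra.
  have [h2|h2] := leP `|j| (4 * `|j2|); first by exists (p + h, q); split => //=; lra.
  have [h3|h3] := leP `|j| (4 * `|j3|); first by exists (p, q + k); split => //=; lra.
  exists (p + h, q + k); split => //=; try lra.
pose nxt n r := projT1 (cid (step n r)).
have nxtP n r : P n r (nxt n r) by exact: projT2 (cid (step n r)).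
pose r := fix r n := if n is m.+1 then nxt m (r m) else (a, c).
have rP n : P n (r n) (r n.+1) by exact: nxtP.
have [x xP] : exists x, forall n, (r n).1 <= x <= (r n).1 + s / 2 ^+ n.
  by apply: nested_intervals => // n; have [] := rP n.
have [y yP] : exists y, forall n, (r n).2 <= y <= (r n).2 + t / 2 ^+ n.
  by apply: nested_intervals => // n; have [] := rP n.
have inx n : a <= (r n).1 /\ (r n).1 + s / 2 ^+ n <= b.
  elim: n => [|n [i1 i2]]; first by rewrite /= expr0 divr1 /s; split; lra.
  by have [p1 p2 _ _ _] := rP n; split; [exact: le_trans p1|exact: le_trans i2].
have iny n : c <= (r n).2 /\ (r n).2 + t / 2 ^+ n <= d.
  elim: n => [|n [i1 i2]]; first by rewrite /= expr0 divr1 /t; split; lra.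
  by have [_ _ p1 p2 _] := rP n; split; [exact: le_trans p1|exact: le_trans i2].
have Jn n : `|J 0 (r 0)| <= 4 ^+ n * `|J n (r n)|.
  elim: n => [|n ih]; first by rewrite expr0 mul1r.
  apply: le_trans ih _; rewrite exprSr -mulrA ler_wpM2l ?exprn_ge0//.
  by have [] := rP n.
have J0 : J 0 (r 0) = mixed_difference Z a b c d.
  by rewrite /J /= expr0 !divr1 /s /t !addrA; congr mixed_difference; ring.
have xab : a <= x <= b.
  by have := xP 0%N; rewrite /= expr0 divr1 /s => /andP[? ?]; apply/andP; split; lra.
have ycd : c <= y <= d.
  by have := yP 0%N; rewrite /= expr0 divr1 /t => /andP[? ?]; apply/andP; split; lra.
have small e : 0 < e -> `|J 0 (r 0)| <= e * (s + t) ^+ 2.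
  move=> e0; have [dl dl0 H] := loc x y xab ycd e e0.
  have [n [ns nt]] : exists n, s / 2 ^+ n < dl /\ t / 2 ^+ n < dl.
    exists (Num.bound ((s + t) / dl)).
    have N0 : (0 : R) < 2 ^+ Num.bound ((s + t) / dl) by rewrite exprn_gt0.
    have : (s + t) / dl < 2 ^+ Num.bound ((s + t) / dl).
      apply: (@lt_trans _ _ (Num.bound ((s + t) / dl))%:R).
        by apply: archi_boundP; apply: divr_ge0; [exact: addr_ge0 | exact: ltW].
      by rewrite -natrX ltr_nat ltn_expl.
    by rewrite ltr_pdivrMr// => st; rewrite !ltr_pdivrMr//; split; lra.
  apply: le_trans (Jn n) _.
  have := H (r n).1 ((r n).1 + s / 2 ^+ n) (r n).2 ((r n).2 + t / 2 ^+ n).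
  have [i1 i2] := inx n; have [i3 i4] := iny n.
  have E (p h : R) : p + h - p = h by ring.
  rewrite !E => /(_ _ _ ns nt) H'.
  have {}H' : `|J n (r n)| <= e * (s / 2 ^+ n + t / 2 ^+ n) ^+ 2 by apply: H'; split.
  have -> : e * (s + t) ^+ 2 = 4 ^+ n * (e * (s / 2 ^+ n + t / 2 ^+ n) ^+ 2).
    have -> : 4 ^+ n = (2 ^+ n) ^+ 2 :> R.
      by rewrite -exprM mulnC exprM; congr (_ ^+ _); ring.
    have : 2 ^+ n != 0 :> R by rewrite expf_neq0 ?pnatr_eq0.
    by move: (2 ^+ n) => q q0; field.
  by rewrite ler_wpM2l ?exprn_ge0.
rewrite -J0; apply/eqP; rewrite -normr_eq0 eq_le normr_ge0 andbT.
apply/ler_addgt0Pl => e e0; rewrite addr0.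
have st0 : 0 < (s + t) ^+ 2 + 1 by rewrite ltr_wpDl ?sqr_ge0.
apply: le_trans (small (e / ((s + t) ^+ 2 + 1)) _) _; first by apply: divr_gt0.
by rewrite mulrAC ler_pdivrMr// ler_wpM2l ?lerDl//; exact: ltW.
Qed.
End RealAnalysis.

(** * A maximum principle on cylinders *)

Section MeanValue.
Variable R : realType.
Implicit Types (a b c d e x y : R) (u v : R -> R -> R).

Definition differentiable2 u x y A B := forall e, 0 < e ->
  exists2 r, 0 < r & forall x' y', `|x' - x| < r -> `|y' - y| < r ->
    `|u x' y' - u x y - A * (x' - x) - B * (y' - y)| <= e * (`|x' - x| + `|y' - y|).

Lemma differentiable2_continuous u x y A B : differentiable2 u x y A B ->
  {for x, continuous (u ^~ y)} /\ {for y, continuous (u x)}.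
Proof.
move=> /(_ 1 ltr01)[r r0 H].
have key (f : R -> R) z K : (forall z', `|z' - z| < r ->
    `|f z' - f z - K * (z' - z)| <= `|z' - z|) -> {for z, continuous f}.
  move=> fz; apply/cvgrPdist_le => /= e e0.
  have K0 : 0 < `|K| + 1 by rewrite ltr_wpDl.
  near=> z'.
  have zr : `|z' - z| < r by near: z'; apply: cvgr_distC_lt.
  have ze : `|z' - z| < e / (`|K| + 1).
    by near: z'; apply: cvgr_distC_lt => //; rewrite divr_gt0.
  have {}fz := fz _ zr.
  rewrite distrC -[f z' - f z](subrK (K * (z' - z))).
  apply: le_trans (ler_normD _ _) _; rewrite normrM.
  by move: ze; rewrite ltr_pdivlMr// => ze; lra.
split.
  apply: (key _ _ A) => z zr; have := H z y zr.
  by rewrite !subrr normr0 mulr0 subr0 addr0 mul1r; exact.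
apply: (key _ _ B) => z zr; have := H x z _ zr.
by rewrite !subrr normr0 mulr0 subr0 add0r mul1r; exact.
Unshelve. all: by end_near. Qed.

(** The form [v dx + u dy] is closed because the two partial derivatives that enter
    its exterior derivative are the same number [A]; on a small rectangle the
    contributions of [A] from the two pairs of sides cancel. *)
Lemma closed_form_rectangle u v (U W : R -> R -> R) a b c d :
  (forall x y, exists A B C, differentiable2 u x y A B /\ differentiable2 v x y C A) ->
  a <= b -> c <= d ->
  (forall x y, c <= y <= d -> is_derive y 1 (U x) (u x y)) ->
  (forall x y, a <= x <= b -> is_derive x 1 (W ^~ y) (v x y)) ->
  mixed_difference (fun x y => U x y - W x y) a b c d = 0.
Proof.
move=> uv ab cd dU dW; apply: mixed_difference_eq0 => // x y xab ycd e e0.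
have [A [B [C [du dv]]]] := uv x y.
have e4 : 0 < e / 4 by rewrite divr_gt0.
have [r1 r10 H1] := du _ e4; have [r2 r20 H2] := dv _ e4.
exists (Num.min r1 r2); first by rewrite lt_min r10.
move=> a' b' c' d' [aa /andP[ax xb] bb] [cc /andP[cy yd] dd].
rewrite !lt_min => /andP[s1 s2] /andP[t1 t2].
set s := b' - a'; set t := d' - c'.
have near1 z : a' <= z <= b' -> `|z - x| <= s.
  by move=> /andP[? ?]; rewrite ler_norml /s; apply/andP; split; lra.
have near2 z : c' <= z <= d' -> `|z - y| <= t.
  by move=> /andP[? ?]; rewrite ler_norml /t; apply/andP; split; lra.
have ca : a' <= a' <= b' by rewrite lexx (le_trans ax).
have cb : a' <= b' <= b' by rewrite lexx andbT (le_trans ax).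
have dc : c' <= c' <= d' by rewrite lexx (le_trans cy).
have dd' : c' <= d' <= d' by rewrite lexx andbT (le_trans cy).
have comb (p q g : R) : `|p| <= e / 4 * (s + t) -> `|q| <= e / 4 * (s + t) ->
    g = p - q -> `|g| <= e / 2 * (s + t).
  by move=> hp hq ->; apply: le_trans (ler_normB _ _) _; lra.
have bnd (p q : R) : p <= s -> q <= t -> e / 4 * (p + q) <= e / 4 * (s + t).
  by move=> ps qt; rewrite ler_wpM2l ?lerD// (ltW e4).
have hU : `|(U b' d' - U a' d') - (U b' c' - U a' c') - A * s * (d' - c')|
    <= e / 2 * (s + t) * (d' - c').
  apply: (@increment_bound R (fun z => U b' z - U a' z) (fun z => u b' z - u a' z)).
  - exact: le_trans yd.
  - move=> z /andP[z1 z2]; apply: is_deriveB; apply: dU; apply/andP; split; lra.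
  move=> z zcd.
  apply: (comb (u b' z - u x y - A * (b' - x) - B * (z - y))
               (u a' z - u x y - A * (a' - x) - B * (z - y))); last by rewrite /s; ring.
    apply: le_trans (H1 _ _ _ _) (bnd _ _ (near1 _ cb) (near2 _ zcd)).
      exact: le_lt_trans (near1 _ cb) _.
    exact: le_lt_trans (near2 _ zcd) _.
  apply: le_trans (H1 _ _ _ _) (bnd _ _ (near1 _ ca) (near2 _ zcd)).
    exact: le_lt_trans (near1 _ ca) _.
  exact: le_lt_trans (near2 _ zcd) _.
have hW : `|(W b' d' - W b' c') - (W a' d' - W a' c') - A * t * (b' - a')|
    <= e / 2 * (s + t) * (b' - a').
  apply: (@increment_bound R (fun z => W z d' - W z c') (fun z => v z d' - v z c')).
  - exact: le_trans xb.
  - move=> z /andP[z1 z2].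
    by apply: (@is_deriveB _ _ _ (W ^~ d') (W ^~ c')); apply: dW; apply/andP; split; lra.
  move=> z zab.
  apply: (comb (v z d' - v x y - C * (z - x) - A * (d' - y))
               (v z c' - v x y - C * (z - x) - A * (c' - y))); last by rewrite /t; ring.
    apply: le_trans (H2 _ _ _ _) (bnd _ _ (near1 _ zab) (near2 _ dd')).
      exact: le_lt_trans (near1 _ zab) _.
    exact: le_lt_trans (near2 _ dd') _.
  apply: le_trans (H2 _ _ _ _) (bnd _ _ (near1 _ zab) (near2 _ dc)).
    exact: le_lt_trans (near1 _ zab) _.
  exact: le_lt_trans (near2 _ dc) _.
have s0 : 0 <= s by rewrite subr_ge0 (le_trans ax).
have t0 : 0 <= t by rewrite subr_ge0 (le_trans cy).
set p := (X in `|X| <= _) in hU; set q := (X in `|X| <= _) in hW.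
have -> : mixed_difference (fun x y => U x y - W x y) a' b' c' d' = p - q.
  by rewrite /mixed_difference /p /q /s /t; ring.
apply: le_trans (ler_normB _ _) _; apply: le_trans (lerD hU hW) _.
have -> : e / 2 * (s + t) * (d' - c') + e / 2 * (s + t) * (b' - a') = e / 2 * (s + t) ^+ 2.
  by rewrite /s /t; ring.
rewrite -/s -/t.
by rewrite ler_wpM2r ?sqr_ge0// ler_pdivrMr//; lra.
Qed.

(** The mean value property in logarithmic polar coordinates [exp (x + iy)]: the
    integral of [u] over a period in [y] does not depend on [x], because the
    contributions of [v] on the two horizontal sides of a rectangle cancel.
    Letting [x] tend to minus infinity, this integral is that of the constant [u0];
    as [u <= u0], equality holds everywhere. *)
Lemma max_principle_cylinder u v (T u0 : R) : 0 < T ->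
  (forall x y, exists A B C, differentiable2 u x y A B /\ differentiable2 v x y C A) ->
  (forall x y, v x (y + 2 * T) = v x y) ->
  (forall e, 0 < e -> exists a, forall x y, x <= a -> `|u x y - u0| <= e) ->
  (forall x y, u x y <= u0) ->
  forall x y, u x y = u0.
Proof.
move=> T0 uv vper ulim umax b y.
have cu x' : continuous (u x').
  by move=> y'; have [A [B [C [/differentiable2_continuous[_ h] _]]]] := uv x' y'.
have cv y' : continuous (v ^~ y').
  by move=> x'; have [A [B [C [_ /differentiable2_continuous[h _]]]]] := uv x' y'.
(* a period centred at [y], so that [y] is an interior point *)
set c := y - T; set d := y + T.
have cd : c <= d by rewrite /c /d; lra.
(* based at [c - 1], hence differentiable at [c] *)
pose U x' := projT1 (cid (antiderivative (c - 1) (cu x'))).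
have dU x' y' : c <= y' <= d -> is_derive y' 1 (U x') (u x' y').
  move=> /andP[cy _]; apply: (projT2 (cid (antiderivative (c - 1) (cu x')))).
  by rewrite ltrBlDr (le_lt_trans cy)// ltrDl.
have mean a : a <= b -> U a d - U a c = U b d - U b c.
  move=> ab.
  (* one antiderivative per function: the same one on the two sides identified
     by the period *)
  have [prim primP] : exists prim : (R -> R) -> R -> R, forall f, continuous f ->
      forall x', a - 1 < x' -> is_derive x' 1 (prim f) (f x').
    have ex (f : R -> R) : exists F : R -> R, continuous f ->
        forall x', a - 1 < x' -> is_derive x' 1 F (f x').
      have [cf|ncf] := pselect (continuous f); last by exists f.
      by have [F dF] := antiderivative (a - 1) cf; exists F.
    by exists (fun f => projT1 (cid (ex f))) => f; exact: projT2 (cid (ex f)).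
  pose W0 y' := prim (v ^~ y').
  have dW0 x' y' : a <= x' <= b -> is_derive x' 1 (W0 y') (v x' y').
    move=> /andP[ax _]; apply: (primP (v ^~ y')) => //.
    by rewrite ltrBlDr (le_lt_trans ax)// ltrDl.
  have W0E : W0 d = W0 c.
    rewrite /W0; have vcd : v ^~ d = v ^~ c.
      by apply/funext => x'; rewrite -(vper x' c); congr v; rewrite /c /d; ring.
    by rewrite vcd.
  have := closed_form_rectangle uv ab cd dU (W := fun x' y' => W0 y' x') dW0.
  by rewrite /mixed_difference /= W0E => H; lra.
have dc : d - c = 2 * T by rewrite /c /d; ring.
have lower : u0 * (d - c) <= U b d - U b c.
  apply/ler_addgt0Pl => e e0.
  have [|a Ha] := ulim (e / (d - c)); first by rewrite divr_gt0// dc mulr_gt0.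
  pose a' := Num.min a b.
  rewrite -(mean a') ?ge_min ?lexx ?orbT//.
  have := @increment_bound R (U a') (u a') u0 (e / (d - c)) c d cd (dU a') _.
  rewrite divfK; last by rewrite dc mulf_neq0// gt_eqF.
  move=> H; have {}H : `|U a' d - U a' c - u0 * (d - c)| <= e.
    by apply: H => z _; apply: Ha; rewrite ge_min lexx.
  by move: H; rewrite ler_norml => /andP[H _]; lra.
(* nondecreasing, with equal values at the ends of the period *)
pose p z := u0 * z - U b z.
have dp z : c <= z <= d -> is_derive z 1 p (u0 - u b z).
  move=> zcd; have := dU b z zcd => h.
  rewrite /p; apply: is_deriveB.
  by apply: is_derive_eq; rewrite /GRing.scale/= mulr1.
have incr z z' : c <= z -> z <= z' -> z' <= d -> p z <= p z'.
  move=> cz zz' zd.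
  have [w /[!in_itv]/= /andP[w1 w2] E] : exists2 w, w \in `[z, z']%R &
      p z' - p z = (u0 - u b w) * (z' - z).
    apply: (@MVT_segment R p (fun w => u0 - u b w)) => // [w /[!in_itv]/= /andP[w1 w2]|].
      by apply: dp; apply/andP; split; lra.
    apply: derivable_within_continuous => w /[!in_itv]/= /andP[w1 w2].
    by have [] : is_derive w 1 p (u0 - u b w) by apply: dp; apply/andP; split; lra.
  by rewrite -subr_ge0 E mulr_ge0// subr_ge0.
have pcst z : c <= z <= d -> p z = p c.
  move=> /andP[cz zd]; apply/eqP; rewrite eq_le (incr c z) ?andbT//.
  by apply: (@le_trans _ _ (p d)); [exact: incr | rewrite /p; lra].
have ycd : c < y < d by rewrite /c /d; apply/andP; split; lra.
have := dp y; case/andP: ycd => cy yd; rewrite !ltW// => /(_ isT) hy.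
suff : is_derive y 1 p 0.
  by move=> [_ h]; case: hy => _; rewrite h => /esym/eqP; rewrite subr_eq0 => /eqP.
have c0 : is_derive (y : R^o) 1 (cst (p c) : R^o -> R^o) 0 by exact: is_derive_cst.
apply: near_eq_is_derive c0.
near=> z; rewrite /= pcst//; apply/andP; split; apply: ltW; near: z.
  exact: lt_nbhsr.
exact: lt_nbhsl.
Unshelve. all: by end_near. Qed.

End MeanValue.

(** * Complex differentiability and the exponential *)

Lemma is_derive_epsP (K : numFieldType) (f : K^o -> K^o) (a l : K^o) :
  is_derive a (1 : K^o) f l <-> forall e : K, 0 < e -> exists2 r : K, 0 < r &
    forall h : K, `|h| < r -> `|f (h + a) - f a - l * h| <= e * `|h|.
Proof.
split=> [[df lf] e e0|H].
  have : (fun h : K => h^-1 *: (f (h *: (1 : K^o) + a) - f a)) @ 0^' --> l by rewrite -lf.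
  move=> /cvgrPdist_le /(_ e e0); rewrite near_withinE => /nbhs_ballP[r /= r0 H].
  exists r => // h hr; have [->|h0] := eqVneq h 0.
    by rewrite add0r mulr0 subr0 subrr normr0 mulr0.
  have := H h; rewrite -ball_normE /= sub0r normrN => /(_ hr h0).
  rewrite -ler_pdivrMr ?normr_gt0//.
  have -> : h *: (1 : K^o) = h by rewrite /GRing.scale/= mulr1.
  move=> H1; apply: le_trans H1.
  rewrite -normfV -normrM distrC mulrBl mulfK//.
  by rewrite /GRing.scale /= mulrC.
have cv : (fun h : K => h^-1 *: (f (h *: (1 : K^o) + a) - f a)) @ 0^' --> l.
  apply/cvgrPdist_le => e e0; rewrite near_withinE; apply/nbhs_ballP.
  have [r r0 {}H] := H e e0; exists r => //= h.
  rewrite -ball_normE /= sub0r normrN => hr h0.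
  have -> : h *: (1 : K^o) = h by rewrite /GRing.scale/= mulr1.
  rewrite -(ler_pM2r (_ : 0 < `|h|)) ?normr_gt0// -normrM mulrBl distrC.
  by rewrite /GRing.scale /= mulrAC mulVf// mul1r; exact: H.
by apply: DeriveDef; [apply/cvg_ex; exists l | exact: cvg_lim].
Qed.

Section ComplexCalculus.
Variable R : realType.
Implicit Types (z w h : R[i]).

Lemma normc_real (a : R) : `|a%:C| = `|a|%:C.
Proof. by rewrite normc_def /= expr0n addr0 sqrtr_sqr. Qed.

Lemma normci : `|'i| = 1 :> R[i].
Proof. by rewrite normc_def /= expr0n expr1n add0r sqrtr1. Qed.

Lemma normc_ge_Im z : `|complex.Im z|%:C <= `|z|.
Proof. by have := normc_ge_Re (z * 'i); rewrite ReiNIm normrN normrM normci mulr1. Qed.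

Lemma normc_le_ReIm (a b : R) : `|a +i* b| <= (`|a| + `|b|)%:C.
Proof.
rewrite [a +i* b]complexE /= rmorphD /=; apply: le_trans (ler_normD _ _) _.
by rewrite normrM normci mul1r !normc_real.
Qed.

Lemma complex_gt0 (e : R[i]) : 0 < e -> exists2 r : R, 0 < r & e = r%:C.
Proof. by case: e => r i; rewrite ltcE/= => /andP[/eqP -> r0]; exists r. Qed.

Lemma normc_normC z : `|z| = (Normc.normc z)%:C. Proof. by []. Qed.

Lemma is_derive_cexp0 : is_derive (0 : R[i]^o) (1 : R[i]^o) (@cexp R : R[i]^o -> R[i]^o) 1.
Proof.
apply/is_derive_epsP => _ /complex_gt0[e e0 ->].
(* the error terms below add up to at most [k |a| + 6 k |b|] *)
have [k [k0 ke k2]] : exists k : R, [/\ 0 < k, 7 * k <= e & k <= 1 / 2].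
  exists (Num.min (e / 7) (1 / 2)); rewrite lt_min !divr_gt0//.
  split=> //; last by rewrite ge_min lexx orbT.
  have : Num.min (e / 7) (1 / 2) <= e / 7 by rewrite ge_min lexx.
  lra.
have [r1 r10 H1] := (@is_derive_epsP R expR 0 (expR 0)).1 (is_derive_expR 0) k k0.
have [r2 r20 H2] := (@is_derive_epsP R cos 0 (- sin 0)).1 (is_derive_cos 0) k k0.
have [r3 r30 H3] := (@is_derive_epsP R sin 0 (cos 0)).1 (is_derive_sin 0) k k0.
exists (Num.min (Num.min r1 r2) (Num.min r3 k))%:C.
  by rewrite ltcR !lt_min r10 r20 r30 k0.
move=> h hr.
have := le_lt_trans (normc_ge_Re h) hr; have := le_lt_trans (normc_ge_Im h) hr.
rewrite !ltcR !lt_min => /andP[/andP[_ b2] /andP[b3 _]] /andP[/andP[a1 _] /andP[_ ak]].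
have := H1 _ a1; have := H2 _ b2; have := H3 _ b3.
rewrite !addr0 sin0 cos0 expR0 subr0 oppr0 mul0r subr0 !mul1r.
have nR := normc_ge_Re h; have nI := normc_ge_Im h.
rewrite cexp0 /cexp.
move: nR nI ak; case: h {hr a1 b2 b3} => a b /= nR nI ak hs hc he.
apply: (@le_trans _ _ (`|expR a * cos b - 1 - a| + `|expR a * sin b - b|)%:C).
  apply: le_trans (normc_le_ReIm _ _); rewrite le_eqVlt; apply/orP; left; apply/eqP; congr (`|_|).
  by apply/eqP; rewrite eq_complex /=; apply/andP; split; apply/eqP; ring.
have ea2 : `|expR a - 1| <= 2 * k.
  rewrite -[expR a - 1](subrK a); apply: le_trans (ler_normD _ _) _.
  have : k * `|a| <= 1 / 2 * `|a| by rewrite ler_wpM2r.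
  lra.
have ea : `|expR a| <= 2.
  rewrite -[expR a](subrK 1); apply: le_trans (ler_normD _ _) _.
  by rewrite normr1; lra.
apply: (@le_trans _ _ (k * `|a| + 6 * k * `|b|)%:C).
  rewrite lecR.
  have -> : k * `|a| + 6 * k * `|b| =
      (k * `|a| + 2 * (k * `|b|)) + (2 * (k * `|b|) + 2 * k * `|b|) by ring.
  apply: lerD.
    have -> : expR a * cos b - 1 - a = (expR a - 1 - a) + expR a * (cos b - 1) by ring.
    by apply: le_trans (ler_normD _ _) _; rewrite lerD// normrM ler_pM.
  have -> : expR a * sin b - b = expR a * (sin b - b) + (expR a - 1) * b by ring.
  by apply: le_trans (ler_normD _ _) _; rewrite lerD// normrM ler_pM.
apply: (@le_trans _ _ ((7 * k)%:C * `|a +i* b|)); last first.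
  by rewrite ler_wpM2r// lecR.
have -> : (7 * k)%:C = k%:C + (6 * k)%:C by rewrite -rmorphD; congr (_%:C); ring.
rewrite (rmorphD _ (k * _)) (rmorphM _ k) (rmorphM _ (6 * k)) (mulrDl k%:C).
by apply: lerD; rewrite ler_wpM2l// ler0c ?mulr_ge0// ltW.
Qed.

Lemma is_derive_cexp z : is_derive (z : R[i]^o) (1 : R[i]^o) (@cexp R : R[i]^o -> R[i]^o) (cexp z).
Proof.
have /is_derive_epsP H := is_derive_cexp0.
apply/is_derive_epsP => e e0.
have c0 : 0 < `|cexp z| + 1 by rewrite ltr_wpDl.
have [|r r0 {}H] := H (e / (`|cexp z| + 1)); first by rewrite divr_gt0.
exists r => // h hr; have := H _ hr; rewrite addr0 cexp0 mul1r.
rewrite mulrAC ler_pdivlMr// => {}H.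
have -> : cexp (h + z) - cexp z - cexp z * h = cexp z * (cexp h - 1 - h).
  by rewrite cexpD; ring.
rewrite normrM; apply: le_trans H; rewrite mulrC ler_wpM2l//.
by rewrite lerDl.
Qed.

Lemma differentiable_cexp z : differentiable (@cexp R : R[i]^o -> R[i]^o) (z : R[i]^o).
Proof. by apply/derivable1_diffP; case: (is_derive_cexp z). Qed.

(** The Cauchy-Riemann equations, [A + iB] being the complex derivative. *)
Lemma cauchy_riemann (f : R[i]^o -> R[i]^o) (x y : R) :
  differentiable f (x +i* y : R[i]^o) -> exists A B,
    differentiable2 (fun s t => complex.Re (f (s +i* t))) x y A (- B) /\
    differentiable2 (fun s t => complex.Im (f (s +i* t))) x y B A.
Proof.
move=> /derivable1_diffP df.
have /is_derive_epsP :
  is_derive (x +i* y : R[i]^o) (1 : R[i]^o) f ('D_1 f (x +i* y : R[i]^o)).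
  exact: DeriveDef.
move: ('D_1 f _) => [A B] H.
have key (e : R) : 0 < e -> exists2 r : R, 0 < r &
    forall s t, `|s - x| < r -> `|t - y| < r ->
      `|f (s +i* t) - f (x +i* y) - (A +i* B) * ((s - x) +i* (t - y))|
      <= (e * (`|s - x| + `|t - y|))%:C.
  move=> e0; have [|_ /complex_gt0[r r0 ->] {}H] := H e%:C; first by rewrite ltcR.
  exists (r / 2) => [|s t sr tr]; first by rewrite divr_gt0.
  have hr : `|(s - x) +i* (t - y)| < r%:C.
    by apply: le_lt_trans (normc_le_ReIm _ _) _; rewrite ltcR; lra.
  have := H _ hr.
  have -> : (s - x) +i* (t - y) + (x +i* y) = s +i* t by rewrite /= /GRing.add/= !subrK.
  move=> {}H; apply: le_trans H _.
  by rewrite rmorphM /= ler_wpM2l ?normc_le_ReIm// ler0c ltW.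
exists A, B; split=> e /key[r r0 {}H]; exists r => // s t sr tr; have {}H := H s t sr tr.
  have := le_trans (normc_ge_Re _) H; rewrite lecR; apply: le_trans.
  rewrite le_eqVlt; apply/orP; left.
  apply/eqP; congr (`|_|); case: (f _) => a1 a2; case: (f _) => b1 b2 /=; ring.
have := le_trans (normc_ge_Im _) H; rewrite lecR; apply: le_trans.
rewrite le_eqVlt; apply/orP; left.
apply/eqP; congr (`|_|); case: (f _) => a1 a2; case: (f _) => b1 b2 /=; ring.
Qed.

End ComplexCalculus.

(** * The maximum modulus principle *)

Section MaxModulus.
Variable R : realType.
Implicit Types (z w : R[i]).

Lemma cexpE (a b : R) : cexp (a +i* b) = (expR a)%:C * (cos b +i* sin b).
Proof. by []. Qed.

Lemma normc_cos_sin (b : R) : `|cos b +i* sin b| = 1.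
Proof. by rewrite normc_def /= cos2Dsin2 sqrtr1. Qed.

Lemma normc_cexp z : `|cexp z| = (expR (complex.Re z))%:C.
Proof. by rewrite normrM normc_cos_sin mulr1 normc_real ger0_norm ?expR_ge0. Qed.

Lemma cexp_neq0 z : cexp z != 0.
Proof.
rewrite -normr_eq0 normc_cexp -(rmorph0 (real_complex R)) (inj_eq (@complexI _)).
by rewrite gt_eqF ?expR_gt0.
Qed.

Lemma cexp_surj z : z != 0 -> exists w, cexp w = z.
Proof.
move=> z0; have [r r0 rE] : exists2 r : R, 0 < r & `|z| = r%:C.
  by apply: complex_gt0; rewrite normr_gt0.
pose a := complex.Re z / r; pose b := complex.Im z / r.
have ab : a ^+ 2 + b ^+ 2 = 1.
  have := add_Re2_Im2 z; rewrite rE -rmorphXn => /complexI H.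
  by rewrite /a /b !expr_div_n -mulrDl H divff// expf_neq0// gt_eqF.
have a1 : -1 <= a <= 1.
  rewrite -ler_norml -(@ler_pXn2r _ 2) ?nnegrE// expr1n -normrX ger0_norm ?sqr_ge0//.
  by rewrite -ab lerDl sqr_ge0.
have [t [ct st]] : exists t : R, cos t = a /\ sin t = b.
  have sb : Num.sqrt (1 - a ^+ 2) = `|b|.
    by rewrite -ab addrAC subrr add0r sqrtr_sqr.
  have [b0|b0] := leP 0 b.
    by exists (acos a); rewrite acosK// sin_acos// sb ger0_norm.
  by exists (- acos a); rewrite cosN sinN acosK// sin_acos// sb ltr0_norm// opprK.
exists (ln r +i* t); rewrite cexpE ct st lnK// /a /b.
have r1 : r != 0 by rewrite gt_eqF.
rewrite [RHS]complexE; apply/eqP; rewrite eq_complex /=.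
by apply/andP; split; apply/eqP; field.
Qed.

(** Normalized by [f 0 = 1], the real part of [f o exp] is bounded by one and tends
    to one at minus infinity, hence it is one; so is [f o exp], being of modulus at
    most one, and the exponential reaches all non-zero numbers. *)
Lemma max_modulus (f : R[i]^o -> R[i]^o) :
  (forall z, differentiable f (z : R[i]^o)) -> (forall z, `|f z| <= `|f 0|) ->
  forall z, f z = f 0.
Proof.
move=> df fmax z.
have [f0|f0] := eqVneq (f 0) 0.
  by apply/eqP; rewrite f0 -normr_le0 (le_trans (fmax z))// f0 normr0.
pose g : R[i]^o -> R[i]^o := (f 0)^-1 *: f.
have gE w : g w = (f 0)^-1 * f w by [].
have dg w : differentiable g (w : R[i]^o) by apply: differentiableZ.
have g0 : g 0 = 1 by rewrite gE mulVf.
have gle w : `|g w| <= 1.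
  by rewrite gE normrM normfV mulrC ler_pdivrMr ?normr_gt0// mul1r.
suff gz : g z = 1.
  by have : f 0 * g z = f z; [rewrite gE mulrA divff ?mul1r | rewrite gz mulr1].
have [->//|z0] := eqVneq z 0.
pose F : R[i]^o -> R[i]^o := g \o (@cexp R : R[i]^o -> R[i]^o).
have dF w : differentiable F (w : R[i]^o).
  by apply: differentiable_comp => //; exact: differentiable_cexp.
have Re1 x y : complex.Re (F (x +i* y)) = 1.
  apply: (@max_principle_cylinder R (fun x y => complex.Re (F (x +i* y)))
    (fun x y => complex.Im (F (x +i* y))) pi 1 (pi_gt0 R)).
  - by move=> s t; have [A [B [h1 h2]]] := cauchy_riemann (dF (s +i* t)); exists A, (- B), B.
  - move=> s t; rewrite /F /= !cexpE.
    by rewrite mulr_natl mulr2n addrA cosDpi sinDpi cosDpi sinDpi !opprK.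
  - move=> e e0.
    have : {for 0, continuous g} by apply: differentiable_continuous.
    move=> /cvgrPdist_le/(_ e%:C); rewrite ltcR => /(_ e0).
    move=> /nbhs_ballP[_ /= /complex_gt0[r r0 ->] H].
    exists (ln r - 1) => s t sr; rewrite -lecR.
    have <- : complex.Re (g 0) = 1 by rewrite g0.
    have := H (cexp (s +i* t)); rewrite -ball_normE /= sub0r normrN normc_cexp ltcR /=.
    have -> : expR s < r by rewrite -ltr_ln ?posrE ?expR_gt0// expRK; lra.
    move=> /(_ isT); apply: le_trans; rewrite distrC; apply: le_trans (normc_ge_Re _).
    by rewrite lecR -raddfB.
  - move=> s t; rewrite -lecR; apply: le_trans (gle (cexp (s +i* t))).
    by apply: le_trans (normc_ge_Re _); rewrite lecR ler_norm.
have [[x y] <-] := cexp_surj z0.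
have := Re1 x y; have := gle (cexp (x +i* y)); rewrite /F /=.
case: (g _) => a b /[swap] /= ->; rewrite normc_def /= -(rmorph1 (real_complex R)) lecR.
rewrite -[leRHS]sqrtr1 ler_sqrt// => b1.
have b0 : b ^+ 2 <= 0 by lra.
by congr Complex; apply/eqP; rewrite -sqrf_eq0 eq_le b0 sqr_ge0.
Qed.
End MaxModulus.

(** * Continuity on a finite dimensional complex space *)

Section Topology.
Variable R : realType.

Lemma lipschitz_continuous (K : numFieldType) (U W : normedModType K)
  (f : U -> W) (M : K) : 0 <= M -> (forall x y, `|f x - f y| <= M * `|x - y|) ->
  continuous f.
Proof.
move=> M0 fM x; apply/cvgrPdist_le => e e0.
have M1 : 0 < M + 1 by rewrite ltr_wpDl.
near=> y.
have : `|x - y| <= e / (M + 1).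
  by near: y; apply: cvgr_dist_le => //; rewrite divr_gt0.
rewrite ler_pdivlMr// mulrC; apply: le_trans.
by apply: le_trans (fM x y) _; rewrite ler_wpM2r// lerDl.
Unshelve. all: by end_near. Qed.

Lemma normc_continuous : continuous (@Normc.normc R : R[i]^o -> R).
Proof.
move=> z; apply/(@cvgrPdist_le _ _ _ _ (nbhs_filter (z : R[i]^o))) => e e0; apply/nbhs_ballP.
exists e%:C; rewrite /= ?ltcR// => w; rewrite -ball_normE /= => zw.
rewrite -lecR -normc_real rmorphB /= -!normc_normC.
exact: le_trans (ler_dist_dist _ _) (ltW zw).
Qed.

Lemma Re_continuous : continuous (@complex.Re R : R[i]^o -> R).
Proof.
move=> z; apply/(@cvgrPdist_le _ _ _ _ (nbhs_filter (z : R[i]^o))) => e e0; apply/nbhs_ballP.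
exists e%:C; rewrite /= ?ltcR// => w; rewrite -ball_normE /= => zw.
by rewrite -lecR -raddfB; exact: le_trans (normc_ge_Re _) (ltW zw).
Qed.

Lemma real_complex_continuous : continuous (fun x : R => x%:C : R[i]^o).
Proof.
move=> x; apply/cvgrPdist_le => _ /complex_gt0[e e0 ->]; near=> y.
rewrite -rmorphB normc_real lecR.
by near: y; apply: cvgr_dist_le.
Unshelve. all: by end_near. Qed.

Variable V : vectType R[i].

Lemma normedE (x : normed V) : `|x| = \sum_i `|coord (vbasis {:V}) i (x : V)|.
Proof. by []. Qed.

(** This covers linear and anti-linear maps: such a map is Lipschitz, since its norm
    at [x] is bounded by the coordinates of [x] times its norms on the basis. *)
Lemma seminormed_continuous (W : normedModType R[i]) (f : normed V -> W) :
  {morph f : x y / x + y} -> (forall c x, `|f (c *: x)| = `|c| * `|f x|) ->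
  continuous f.
Proof.
move=> fD fZ.
have f0 : f 0 = 0 by apply: (addIr (f 0)); rewrite -fD !add0r.
have fN x : f (- x) = - f x by apply: (addrI (f x)); rewrite -fD !subrr.
pose e i : normed V := (vbasis {:V})`_i.
pose M := \sum_i `|f (e (i : 'I_(\dim {:V})))|.
apply: (@lipschitz_continuous _ _ _ _ M) => [|x y]; first exact: sumr_ge0.
rewrite -fN -fD; set z : normed V := x - y.
rewrite {1}(coord_vbasis (memvf (z : V)) : z = \sum_i _).
have -> : f (\sum_i coord (vbasis {:V}) i (z : V) *: e i) =
   \sum_i f (coord (vbasis {:V}) i (z : V) *: e i).
  exact: (big_morph f fD f0).
apply: le_trans (ler_norm_sum _ _ _) _.
rewrite normedE mulr_sumr; apply: ler_sum => i _.
rewrite fZ mulrC ler_wpM2r// /M (bigD1 i)//= lerDl sumr_ge0//.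
Qed.

Lemma linear_fun_differentiable (f : V -> R[i]) (x : normed V) :
  {morph f : x y / x + y} -> (forall c x, f (c *: x) = c * f x) ->
  differentiable (f : normed V -> R[i]^o) x.
Proof.
move=> fD fZ.
have fc : continuous (f : normed V -> R[i]^o).
  by apply: seminormed_continuous => // c y; rewrite fZ normrM.
have fl : linear (f : normed V -> R[i]^o) by move=> c u v; rewrite fD fZ.
pose flM := GRing.isLinear.Build _ _ _ _ _ fl.
pose fL : {linear normed V -> R[i]^o} := HB.pack (f : normed V -> R[i]^o) flM.
exact: (@linear_differentiable _ _ _ fL x fc).
Qed.

Lemma line_differentiable (v u : normed V) (c : R[i]) :
  differentiable (fun c : R[i]^o => v + c *: u) (c : R[i]^o).
Proof. by apply: differentiableD. Qed.

Lemma real_line_continuous (v u : normed V) :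
  continuous (fun t : R => v + t%:C *: u).
Proof.
move=> t.
apply: (@continuous_comp _ _ _ (fun t : R => t%:C : R[i]^o) (fun c : R[i]^o => v + c *: u)).
  exact: real_complex_continuous.
by apply: differentiable_continuous; exact: line_differentiable.
Qed.

End Topology.

(** * Compactness of the torus *)

Section Lattice.
Variables (R : realType) (V : vectType R[i]) (Lam : zmodClosed V).

(** The real span of the lattice contains [e] and [ie] for the vectors [e] of a
    complex basis, and finitely many lattice vectors suffice to express those. *)
Lemma real_span_basis (hLam : maximal_lattice Lam) : exists (N : nat) (l : 'I_N -> V),
  (forall i, l i \in Lam) /\
  forall v : V, exists s : 'I_N -> R, v = \sum_i (s i)%:C *: l i.
Proof.
case: hLam => _ span.
pose n := \dim {:V}.
pose e (k : 'I_n * bool) : V :=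
  if k.2 then 'i *: (vbasis {:V})`_k.1 else (vbasis {:V})`_k.1.
have sp k : {N : nat & {tl : ('I_N -> R) * ('I_N -> V) |
    (forall i, tl.2 i \in Lam) /\ e k = \sum_i (tl.1 i)%:C *: tl.2 i}}.
  have [N /cid[t /cid[l lP]]] := cid (span (e k)).
  by exists N, (t, l).
pose N k := projT1 (sp k).
pose t k : 'I_(N k) -> R := (sval (projT2 (sp k))).1.
pose l k : 'I_(N k) -> V := (sval (projT2 (sp k))).2.
have lP k : (forall i, l k i \in Lam) /\ e k = \sum_i (t k i)%:C *: l k i.
  exact: (svalP (projT2 (sp k))).
pose I := {k : 'I_n * bool & 'I_(N k)}.
exists #|{: I}|, (fun j => l (tag (enum_val j)) (tagged (enum_val j))).
split=> [j|v]; first by have [h _] := lP (tag (enum_val j)); exact: h.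
pose r (k : 'I_n * bool) : R := let c := coord (vbasis {:V}) k.1 v in
  if k.2 then complex.Im c else complex.Re c.
exists (fun j => r (tag (enum_val j)) * t (tag (enum_val j)) (tagged (enum_val j))).
rewrite -(reindex (@enum_val _ {: I}) (onW_bij _ (enum_val_bij _)) (P := xpredT)
  (F := fun x : I => (r (tag x) * t (tag x) (tagged x))%:C *: l (tag x) (tagged x))) /=.
rewrite -(sig_big_dep xpredT (fun=> xpredT) (fun k (i : 'I_(N k)) => (r k * t k i)%:C *: l k i)) /=.
have -> : \sum_(k : 'I_n * bool) \sum_(i < N k) (r k * t k i)%:C *: l k i =
   \sum_(k : 'I_n * bool) (r k)%:C *: e k.
  apply: eq_bigr => k _; have [_ ->] := lP k; rewrite scaler_sumr.
  by apply: eq_bigr => i _; rewrite rmorphM scalerA.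
rewrite -(pair_bigA _ (fun i b => (r (i, b))%:C *: e (i, b))) /=.
rewrite {1}(coord_vbasis (memvf v)); apply: eq_bigr => i _.
rewrite (bigD1 true)//= (bigD1 false)//= big1 ?addr0; last by case.
rewrite /r /e /= scalerA -scalerDl; congr (_ *: _).
by rewrite [LHS]complexE addrC (mulrC 'i).
Qed.

(** The torus is compact because it is the image of a cube: replace the real
    coefficients on lattice vectors by their fractional parts. *)
Lemma lattice_cover (hLam : maximal_lattice Lam) : exists (N : nat) (l : 'I_N -> V),
  (forall i, l i \in Lam) /\
  forall v : V, exists2 s : 'I_N -> R, (forall i, 0 <= s i <= 1) &
    v - \sum_i (s i)%:C *: l i \in Lam.
Proof.
have [N [l [lL lspan]]] := real_span_basis hLam.
exists N, l; split=> // v; have [s ->] := lspan v.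
exists (fun i => s i - (Num.floor (s i))%:~R) => [i|].
  have /andP[f1 f2] := Num.Theory.floor_itv (s i).
  by move: f2; rewrite intrD => f2; apply/andP; split; lra.
rewrite -sumrB rpred_sum// => i _.
rewrite -scalerBl -rmorphB opprB addrC subrK.
by rewrite rmorph_int scaler_int rpredMz.
Qed.
End Lattice.

(** * Nowhere zero sections of line bundles on the torus *)

Lemma sum_continuous (K : numFieldType) (T : topologicalType) (W : normedModType K)
  (I : finType) (g : I -> T -> W) :
  (forall i, continuous (g i)) -> continuous (fun t => \sum_i g i t).
Proof.
move=> cg; have -> : (fun t => \sum_i g i t) = \sum_i g i.
  by apply/funext => t; rewrite fct_sumE.
elim/big_ind : _ => [|f h cf ch|i _]; last exact: cg.
  by move=> t; exact: cvg_cst.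
by move=> t; apply: cvgD; [exact: cf|exact: ch].
Qed.

Section Theta.
Variables (R : realType) (V : vectType R[i]) (Lam : zmodClosed V).

Definition hermitian_form (B : V -> V -> R[i]) : Prop :=
  [/\ forall u v w, B u (v + w) = B u v + B u w,
      forall u c v, B u (c *: v) = c * B u v &
      forall u v, B v u = (B u v)^*].

Section Hermitian.
Variables (B : V -> V -> R[i]) (hB : hermitian_form B).

Lemma herm_addr u : {morph B u : v w / v + w}. Proof. by case: hB => *. Qed.
Lemma herm_scaler u c v : B u (c *: v) = c * B u v. Proof. by case: hB => *. Qed.
Lemma herm_conj u v : B v u = (B u v)^*. Proof. by case: hB => *. Qed.

Lemma herm_addl v : {morph B^~ v : u w / u + w}.
Proof.
move=> u w.
by rewrite (herm_conj v (u + w)) (herm_conj v u) (herm_conj v w) herm_addr rmorphD.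
Qed.

Lemma herm_scalel u c v : B (c *: u) v = conjc c * B u v.
Proof. by rewrite (herm_conj v (c *: u)) herm_scaler rmorphM (herm_conj v u). Qed.

Lemma herm0r u : B u 0 = 0.
Proof. by apply: (addrI (B u 0)); rewrite -herm_addr !addr0. Qed.

Lemma herm_oppr u v : B u (- v) = - B u v.
Proof. by rewrite -scaleN1r herm_scaler mulN1r. Qed.

Lemma herm0l u : B 0 u = 0.
Proof. by rewrite herm_conj herm0r conjc0. Qed.

Lemma herm_sqrD u v : complex.Re (B (u + v) (u + v)) =
  complex.Re (B u u) + 2 * complex.Re (B u v) + complex.Re (B v v).
Proof.
rewrite herm_addl !herm_addr (herm_conj u v).
by case: (B u u) (B u v) (B v v) => [a b] [c d] [e f] /=; ring.
Qed.

Lemma herm_diag u : B u u = (complex.Re (B u u))%:C.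
Proof.
have := herm_conj u u; case: (B u u) => a b [] /eqP.
by rewrite -subr_eq0 opprK -mulr2n mulrn_eq0 /= => /eqP ->.
Qed.

(** Polarization: the real part of [B u v] vanishes for all [u] and [v]; apply this
    also to ['i *: v]. *)
Lemma herm_eq0 : (forall u, complex.Re (B u u) = 0) -> forall u v, B u v = 0.
Proof.
move=> B0 u v.
have re w : complex.Re (B u w) = 0.
  have := herm_sqrD u w; rewrite !B0 add0r addr0 => /esym/eqP.
  by rewrite mulf_eq0 pnatr_eq0 /= => /eqP.
have := re ('i *: v); have := re v; rewrite herm_scaler.
by case: (B u v) => a b /= ->; rewrite mul0r mul1r sub0r => /eqP; rewrite oppr_eq0 => /eqP ->.
Qed.
End Hermitian.

Section QuasiPeriodic.
Variables (B : V -> V -> R[i]) (hB : hermitian_form B).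
Variable G : normed V -> R[i]^o.
Hypothesis dG : forall v, differentiable G v.
Hypothesis hLam : maximal_lattice Lam.
(* the functional equation of a section, in absolute value: the unitary
   multipliers given by a semi-character do not change the norm *)
Hypothesis GB : forall l v, l \in Lam ->
  `|G (v + l)| = `|cexp (pi%:C * (B l v + 2^-1 * B l l))| * `|G v|.

(** The norm of the section [G] for the metric [exp (- pi B(v, v))] of the bundle. *)
Let P v := Normc.normc (G v) * expR (- (pi / 2 * complex.Re (B v v))).

Lemma section_norm_periodic l v : l \in Lam -> P (v + l) = P v.
Proof.
move=> Ll; have := GB v Ll.
rewrite normc_cexp !normc_normC -rmorphM => /complexI E.
rewrite /P E mulrAC -expRD (mulrC (expR _)); congr (_ * expR _).
rewrite herm_sqrD// (herm_conj hB l v) (herm_diag hB l).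
by case: (B l v) (B v v) (B l l) => [a b] [c d] [e f] /=; field.
Qed.

(** By periodicity, the norm takes all its values on a compact parallelepiped. *)
Lemma section_norm_max : exists v0, forall v, P v <= P v0.
Proof.
have [N [l [lL lcov]]] := lattice_cover hLam.
pose L (t : 'rV[R]_N) : normed V := \sum_i (t ord0 i)%:C *: l i.
pose K : set 'rV[R]_N := [set t | forall i, (`[(0 : R), 1]%classic : set R) (t ord0 i)].
have cK : compact K.
  by apply: (@rV_compact R N (fun=> `[(0 : R), 1]%classic)) => i; exact: segment_compact.
have K0 : K !=set0 by exists 0 => i; rewrite mxE /= in_itv/= lexx ler01.
have cti i : continuous (fun t : 'rV[R]_N => t ord0 i) by exact: coord_continuous.
have cL : continuous L.
  apply: sum_continuous => i t.
  apply: (@continuous_comp _ _ _ (fun t : 'rV[R]_N => t ord0 i)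
    (fun x : R => x%:C *: (l i : normed V))).
    exact: cti.
  rewrite (_ : (fun x : R => _) = (fun x : R => 0 + x%:C *: (l i : normed V))); last first.
    by apply/funext => x; rewrite add0r.
  exact: real_line_continuous.
have BL t : complex.Re (B (L t) (L t)) =
    \sum_i \sum_j t ord0 i * t ord0 j * complex.Re (B (l i) (l j)).
  rewrite /L (big_morph (B^~ _) (herm_addl hB _) (herm0l hB _)) raddf_sum /=.
  apply: eq_bigr => i _; rewrite (big_morph _ (herm_addr hB _) (herm0r hB _)) raddf_sum /=.
  apply: eq_bigr => j _; rewrite herm_scaler// herm_scalel//.
  by case: (B _ _) => a b /=; ring.
pose f t := P (L t).
have cf : continuous f.
  have cG : continuous (fun v : normed V => Normc.normc (G v)).
    move=> v; apply: (@continuous_comp _ _ _ G (@Normc.normc R)); last exact: normc_continuous.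
    exact: differentiable_continuous.
  have cGL : continuous (fun t => Normc.normc (G (L t))).
    move=> t; apply: (@continuous_comp _ _ _ L (fun v : normed V => Normc.normc (G v))).
      exact: cL.
    exact: cG.
  have cB : continuous (fun t => complex.Re (B (L t) (L t))).
    rewrite (funext BL).
    apply: (@sum_continuous R _ R^o _ (fun i (t : 'rV[R]_N) =>
      \sum_j t ord0 i * t ord0 j * complex.Re (B (l i) (l j)))) => i.
    apply: (@sum_continuous R _ R^o _ (fun j (t : 'rV[R]_N) =>
      t ord0 i * t ord0 j * complex.Re (B (l i) (l j)))) => j t.
    exact: (cvgM (cvgM (cti i t) (cti j t)) (cvg_cst _)).
  suff cE : continuous (fun t => expR (- (pi / 2 * complex.Re (B (L t) (L t))))).
    by move=> t; exact: cvgM (cGL t) (cE t).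
  move=> t; apply: (@continuous_comp _ _ _
    (fun t => - (pi / 2 * complex.Re (B (L t) (L t)))) expR); last first.
    exact: continuous_expR.
  exact: (cvgN (cvgM (cvg_cst (pi / 2)) (cB t))).
have [t0 _ t0max] := compact_EVT_max K0 cK (continuous_subspaceT cf).
exists (L t0) => v.
have [s s01 sL] := lcov v.
have -> : P v = f (\row_i s i).
  rewrite /f -[v](subrK (\sum_i (s i)%:C *: l i)) addrC section_norm_periodic//.
  by congr P; apply: eq_bigr => i _; rewrite mxE.
by apply: t0max; rewrite inE => i /=; rewrite mxE in_itv/=.
Qed.

(** Along a complex line through a maximum [v0] of the norm of the section, the
    twist by [exp (- pi c B(v0, u))] removes the terms linear in [c] from the bound
    on the section: the result is an entire function of [c] bounded by its value at
    [0] times [exp (pi / 2 |c|^2 B(u, u))], to which the maximum modulus principle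
    applies. *)
Lemma section_line_cst v0 u : (forall v, P v <= P v0) -> complex.Re (B u u) <= 0 ->
  (G v0 != 0 -> complex.Re (B u u) = 0) /\
  forall c, G (v0 + c *: u) * cexp (- (pi%:C * B v0 u) * c) = G v0.
Proof.
move=> v0max Bu0.
set b := B v0 u.
pose f : R[i]^o -> R[i]^o := fun c => G (v0 + c *: u) * cexp (- (pi%:C * b) * c).
have f0 : f 0 = G v0 by rewrite /f mulr0 cexp0 mulr1 scale0r addr0.
have fle c : `|f c| <= `|f 0| * (expR (pi / 2 * Normc.normc c ^+ 2 * complex.Re (B u u)))%:C.
  rewrite f0 /f normrM normc_cexp !normc_normC -!rmorphM lecR.
  have := v0max (v0 + c *: u); rewrite /P herm_sqrD// -/b.
  rewrite herm_scaler// (herm_scaler hB (c *: u)) (herm_scalel hB u) -/b.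
  have -> : complex.Re (c * (conjc c * B u u)) = Normc.normc c ^+ 2 * complex.Re (B u u).
    have cc : c * conjc c = (Normc.normc c ^+ 2)%:C by rewrite -sqr_normc normc_normC -rmorphXn.
    by rewrite mulrA cc; case: (B u u) => x y /=; ring.
  rewrite -(mulrA (pi / 2)); set q := _ ^+ 2 * _; set p := complex.Re (B v0 v0).
  have -> : complex.Re (- (pi%:C * b) * c) = - pi * complex.Re (c * b).
    by case: (b) (c) => [x y] [x' y'] /=; ring.
  set r := complex.Re (c * b); set n1 := Normc.normc _; set n2 := Normc.normc _.
  rewrite -(ler_pM2r (expR_gt0 (pi / 2 * (p + q)))) -(mulrA n1) -(mulrA n2) -!expRD => H.
  have e1 : - (pi / 2 * (p + 2 * r + q)) + pi / 2 * (p + q) = - pi * r by field.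
  have e2 : - (pi / 2 * p) + pi / 2 * (p + q) = pi / 2 * q by field.
  by rewrite -e1 -e2.
have B1 c : expR (pi / 2 * Normc.normc c ^+ 2 * complex.Re (B u u)) <= 1.
  rewrite -expR0 ler_expR mulr_ge0_le0// mulr_ge0 ?sqr_ge0// divr_ge0//.
  exact: pi_ge0.
have fcst : forall c, f c = f 0.
  apply: max_modulus => c; last first.
    by apply: le_trans (fle c) _; rewrite ler_piMr// -(rmorph1 (real_complex R)) lecR.
  apply: differentiableM.
    apply: (@differentiable_comp _ _ _ _ (fun c : R[i]^o => (v0 + c *: u : normed V))).
      exact: line_differentiable.
    exact: dG.
  apply: (@differentiable_comp _ _ _ _ (fun c : R[i]^o => - (pi%:C * b) * c : R[i]^o)).
    by apply: (@differentiableZ _ _ _ (id : R[i]^o -> R[i]^o)).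
  exact: differentiable_cexp.
split; last by move=> c; rewrite -/(f c) fcst f0.
move=> G0; apply/eqP; rewrite eq_le Bu0 /=.
have := fle 1; rewrite fcst f0 -[leLHS]mulr1 ler_pM2l ?normr_gt0//.
rewrite Normc.normc1 expr1n mulr1 -(rmorph1 (real_complex R)) lecR -expR0 ler_expR.
by rewrite pmulr_rge0// divr_gt0// pi_gt0.
Qed.

Lemma section_semipositive : (forall v, G v != 0) -> forall u, 0 <= complex.Re (B u u).
Proof.
move=> G0 u; have [v0 v0max] := section_norm_max.
have [//|Bu] := leP 0 (complex.Re (B u u)).
have [H _] := section_line_cst (u := u) v0max (ltW Bu).
by move: Bu; rewrite H ?ltxx.
Qed.

End QuasiPeriodic.

(** Injectivity of the Appell-Humbert parametrization: a nowhere zero section [G]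
    forces the Hermitian form to be positive, and [G^-1], a section of the dual
    bundle, forces it to be negative. *)
Lemma nonvanishing_section (B : V -> V -> R[i]) (G : normed V -> R[i]^o) :
  maximal_lattice Lam -> hermitian_form B -> (forall v, differentiable G v) ->
  (forall v, G v != 0) ->
  (forall l v, l \in Lam ->
     `|G (v + l)| = `|cexp (pi%:C * (B l v + 2^-1 * B l l))| * `|G v|) ->
  (forall u v, B u v = 0) /\ (forall v, G v = G 0).
Proof.
move=> hLam hB dG G0 GB.
have BN : hermitian_form (fun u v => - B u v).
  case: hB => BD BZ BJ; split=> [u v w|u c v|u v].
  - by rewrite BD opprD.
  - by rewrite BZ mulrN.
  - by rewrite BJ rmorphN.
have dGV v : differentiable (fun v => (G v)^-1 : R[i]^o) v.
  exact: differentiableV.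
have GVB l v : l \in Lam -> `|(G (v + l))^-1| =
    `|cexp (pi%:C * (- B l v + 2^-1 * - B l l))| * `|(G v)^-1|.
  move=> Ll; rewrite !normfV GB// invfM; congr (_ * _).
  apply: (mulfI (x := `|cexp (pi%:C * (B l v + 2^-1 * B l l))|)).
    by rewrite normr_eq0 cexp_neq0.
  rewrite divff ?normr_eq0 ?cexp_neq0// -normrM -cexpD.
  have -> : pi%:C * (B l v + 2^-1 * B l l) + pi%:C * (- B l v + 2^-1 * - B l l) = 0 :> R[i] by ring.
  by rewrite cexp0 normr1.
have B0 : forall u v, B u v = 0.
  apply: (herm_eq0 hB) => u; apply/eqP.
  rewrite eq_le (section_semipositive hB dG hLam GB G0 u) andbT.
  have := section_semipositive BN dGV hLam GVB _ u.
  rewrite raddfN oppr_ge0; apply=> v.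
  by rewrite invr_eq0.
split=> // v.
have [v0 v0max] := section_norm_max hB dG hLam GB.
have Gv0 w : G w = G v0.
  have [|_ /(_ 1)] := section_line_cst hB dG (u := w - v0) v0max.
    by rewrite B0.
  by rewrite B0 mulr0 oppr0 mul0r cexp0 mulr1 scale1r addrC subrK.
by rewrite Gv0 (Gv0 0).
Qed.
End Theta.

(** * Points and local coordinates of the line bundle *)

Lemma near_differentiable (K : numFieldType) (U W : normedModType K) (f g : U -> W)
    (x : U) : (\forall y \near x, f y = g y) -> differentiable f x -> differentiable g x.
Proof.
move=> fg df; have fgx : f x = g x := nbhs_singleton fg.
have dgE : g \o shift x = cst (g x) + 'd f x +o_ (0 : U) id.
  apply/eqaddoP => e e0.
  have /eqaddoP/(_ e e0) := diff_locally df.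
  have : \forall h \near (0 : U), f (h + x) = g (h + x).
    by have := fg; rewrite (near_shift 0) subr0.
  apply: filterS2 => h /= fgh; rewrite !fctE /= fgh fgx; exact.
have cdf : continuous ('d f x) by exact: diff_continuous.
apply/diff_locallyP; rewrite (diff_unique cdf dgE); split=> //.
Qed.

Lemma differentiable_fst (K : numFieldType) (U W : normedModType K) (p : U * W) :
  differentiable (fst : U * W -> U) p.
Proof.
have fl : linear (fst : U * W -> U) by [].
pose fM := GRing.isLinear.Build _ _ _ _ _ fl.
pose fL : {linear (U * W)%type -> U} := HB.pack (fst : U * W -> U) fM.
by apply: (@linear_differentiable _ _ _ fL); move=> x; exact: cvg_fst.
Qed.

Lemma differentiable_snd (K : numFieldType) (U W : normedModType K) (p : U * W) :
  differentiable (snd : U * W -> W) p.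
Proof.
have fl : linear (snd : U * W -> W) by [].
pose fM := GRing.isLinear.Build _ _ _ _ _ fl.
pose fL : {linear (U * W)%type -> W} := HB.pack (snd : U * W -> W) fM.
by apply: (@linear_differentiable _ _ _ fL); move=> x; exact: cvg_snd.
Qed.

Section Bundle.
Variables (R : realType) (V : vectType R[i]) (Lam : zmodClosed V) (D : AH_datum Lam).
Local Notation E := (AH_total D).
Local Notation H := (AH_form D).
Local Notation alpha := (AH_char D).
Local Notation ptE v z := (\pi_E ((v : normed V), (z : R[i]^o))).

Lemma AH_form_herm : hermitian_form H.
Proof. by split; [exact: AH_formDr | exact: AH_formZr | exact: AH_formJ]. Qed.

Lemma AH_char_neq0 l : l \in Lam -> alpha l != 0.
Proof. by move=> Ll; rewrite -normr_eq0 AH_char_norm// oner_eq0. Qed.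

Lemma AH_pt_translate l v z : l \in Lam -> ptE v z = ptE (v + l) (AH_factor D l v * z).
Proof. by move=> Ll; apply/AH_piP/asboolP; exists l. Qed.

Lemma AH_pt_inj v : injective (fun z => ptE v z).
Proof.
move=> z z' /AH_piP/asboolP[l Ll [/= vl ->]].
have -> : l = 0 by apply: (addrI v); rewrite -vl addr0.
by rewrite AH_factor0 mul1r.
Qed.

Lemma AH_fibre (v : normed V) (e : E) : AH_proj e = \pi_(torus Lam) v -> exists z, e = ptE v z.
Proof.
case: (repr e) (reprK e) => w y <-; rewrite AH_proj_pi /= => /torus_piP wv.
exists (AH_factor D (v - w) w * y).
have -> : v = w + (v - w) by rewrite addrC subrK.
rewrite {2}[w + _]addrC addrK; apply: AH_pt_translate.
by rewrite -opprB rpredN.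
Qed.

Lemma AH_factor_differentiable l (v : normed V) :
  differentiable (AH_factor D l : normed V -> R[i]^o) v.
Proof.
have dH : differentiable (H l : normed V -> R[i]^o) v.
  by apply: (@linear_fun_differentiable R V (H l)); [exact: AH_formDr | exact: AH_formZr].
have dh : differentiable (fun z : R[i]^o =>
    alpha l * cexp (pi%:C * (z + 2^-1 * H l l)) : R[i]^o) (H l v : R[i]^o).
  apply: (@differentiableZ _ _ _ (fun z : R[i]^o => cexp (pi%:C * (z + 2^-1 * H l l)) : R[i]^o)).
  apply: (@differentiable_comp _ _ _ _ (fun z : R[i]^o => pi%:C * (z + 2^-1 * H l l) : R[i]^o)).
    apply: (@differentiableZ _ _ _ (fun z : R[i]^o => z + 2^-1 * H l l : R[i]^o)).
    by apply: differentiableD.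
  exact: differentiable_cexp.
exact: (@differentiable_comp _ _ _ _ (H l : normed V -> R[i]^o) _ _ dH dh).
Qed.

(** Two points of a small ball are never congruent modulo the lattice, which is
    discrete; so over such a ball the fibre coordinate is well defined, and over
    its translate by [- l] it is the fibre coordinate there times the factor of
    automorphy of [l], which is holomorphic.  These coordinates detect holomorphy
    of maps to the bundle. *)
Lemma AH_chart (hLam : maximal_lattice Lam) (w0 : normed V) :
  exists (r : R[i]) (U : set E) (f : E -> R[i]), [/\ 0 < r, AH_holo U f &
    forall (w : normed V) z, ball w0 r w -> U (ptE w z) /\ f (ptE w z) = z].
Proof.
have [[N oN dis] _] := hLam.
have /nbhs_ballP[r /= r0 rN] := open_nbhs_nbhs oN.
have r2 : 0 < r / 2 by rewrite divr_gt0.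
have uniq (w w' : normed V) z z' : ball w0 (r / 2) w -> ball w0 (r / 2) w' ->
    ptE w z = ptE w' z' -> z = z'.
  move=> bw bw' /AH_piP/asboolP[l Ll [/= wl ->]].
  suff -> : l = 0 by rewrite AH_factor0 mul1r.
  apply: dis => //; apply: rN.
  have -> : l = (w' : V) - w by rewrite wl addrC addKr.
  have := ball_triangle (ball_sym bw) bw'; rewrite -splitr.
  by rewrite -!ball_normE /= sub0r opprB.
pose U : set E := [set e | exists w z, ball w0 (r / 2) w /\ e = ptE w z].
pose f (e : E) : R[i] := xget 0 [set z | exists w, ball w0 (r / 2) w /\ e = ptE w z].
have fE w z : ball w0 (r / 2) w -> f (ptE w z) = z.
  move=> bw; apply: xget_unique; first by exists w.
  by move=> z' [w' [bw' e]]; exact/esym/(uniq _ _ _ _ bw bw' e).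
exists (r / 2), U, f; split=> //; last first.
  by move=> w z bw; split; [exists w, z | exact: fE].
have UE v y : U (ptE v y) <-> exists2 l, l \in Lam & ball (w0 - l) (r / 2) v.
  split=> [[w [z [bw /AH_piP/asboolP[l Ll [/= wE _]]]]]|[l Ll bv]].
    by exists l => //; move: bw; rewrite -!ball_normE /= wE opprD addrA addrAC.
  exists (v + l), (AH_factor D l v * y); split; last exact: AH_pt_translate.
  by move: bv; rewrite -!ball_normE /= opprD addrA addrAC.
split.
  have cfst : continuous (fst : normed V * R[i]^o -> normed V) by move=> p; exact: cvg_fst.
  have oA : open (\bigcup_(l in [set l : V | l \in Lam]) ball (w0 - l : normed V) (r / 2)).
    by apply: bigcup_open => l _; exact: ball_open.
  have : open ((fun p => \pi_E p) @^-1` U).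
    rewrite (_ : _ @^-1` U = fst @^-1` (\bigcup_(l in [set l : V | l \in Lam])
        ball (w0 - l : normed V) (r / 2))).
      by move/continuousP: cfst; apply.
    apply/seteqP; split=> -[v y] /=; first by move=> /UE[l Ll bv]; exists l.
    by move=> [l Ll bv]; apply/UE; exists l.
  by [].
move=> [v y] /UE[l Ll bv].
apply: (@near_differentiable _ _ _ (fun p : normed V * R[i]^o => AH_factor D l p.1 * p.2 : R[i]^o)).
  have : \forall p \near ((v, y) : normed V * R[i]^o), ball (w0 - l : normed V) (r / 2) p.1.
    have : nbhs v (ball (w0 - l : normed V) (r / 2)).
      by apply: open_nbhs_nbhs; split=> //; exact: ball_open.
    by apply: cvg_fst.
  apply: filterS => -[v' y'] /= bv'; rewrite (AH_pt_translate v' y' Ll) fE//.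
  by move: bv'; rewrite -!ball_normE /= opprD addrA addrAC.
apply: differentiableM; last exact: differentiable_snd.
apply: (@differentiable_comp _ _ _ _ fst (AH_factor D l : normed V -> R[i]^o)).
  exact: differentiable_fst.
exact: AH_factor_differentiable.
Qed.

Lemma AH_holo_continuous U (f : E -> R[i]) : AH_holo U f ->
  forall e, U e -> {for e, continuous (f : E -> R[i]^o)}.
Proof.
move=> [oU dU] e Ue N /= nN.
have [N' [oN' N'f] N'N] : exists2 N', open_nbhs (f e : R[i]^o) N' & N' `<=` N.
  by move: nN; rewrite nbhsE => -[N' ? ?]; exists N'.
rewrite nbhsE; exists (U `&` f @^-1` N'); last by move=> x [_ /N'N].
split=> //.
have : open ((fun p => \pi_E p) @^-1` (U `&` f @^-1` N')); last by [].
rewrite openE => p [Up Np]; rewrite /interior.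
apply: filterI.
  have oU' : open ((fun p => \pi_E p) @^-1` U) by exact: oU.
  by apply: open_nbhs_nbhs.
have := differentiable_continuous (dU p Up); apply.
exact: open_nbhs_nbhs.
Qed.

End Bundle.

(** * Anti-holomorphic lifts of the involution *)

Section RealStructure.
Variables (R : realType) (V : vectType R[i]) (Lam : zmodClosed V) (D : AH_datum Lam).
Local Notation E := (AH_total D).
Local Notation H := (AH_form D).
Local Notation alpha := (AH_char D).
Local Notation ptE v z := (\pi_E ((v : normed V), (z : R[i]^o))).

Variable tau : V -> V.
Hypotheses (hLam : maximal_lattice Lam) (tau_anti : antilinear tau).
Hypotheses (tau_invol : involutive tau) (tau_Lam : {in Lam, forall l, tau l \in Lam}).

Lemma conjcM (a b : R[i]) : conjc (a * b) = conjc a * conjc b.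
Proof. by rewrite rmorphM. Qed.

Lemma conjcD (a b : R[i]) : conjc (a + b) = conjc a + conjc b.
Proof. by rewrite rmorphD. Qed.

Lemma conjc_cexp (z : R[i]) : conjc (cexp z) = cexp (conjc z).
Proof.
rewrite /cexp; case: z => a b /=; rewrite cosN sinN.
by apply/eqP; rewrite eq_complex /=; apply/andP; split; apply/eqP; ring.
Qed.

Lemma antilinear_continuous : continuous (tau : normed V -> normed V).
Proof.
have [tD tZ] := tau_anti.
by apply: seminormed_continuous => // c x; rewrite tZ normrZ normcJ.
Qed.

Lemma antilinear0 : tau 0 = 0.
Proof. by have [tD _] := tau_anti; apply: (addIr (tau 0)); rewrite -tD !add0r. Qed.

Lemma conjc_factor_exponent (x y : R[i]) :
  conjc (pi%:C * (x + 2^-1 * y)) = pi%:C * (conjc x + 2^-1 * conjc y).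
Proof.
by rewrite conjcM conjcD conjcM conjc_inv conjc_nat conjc_real.
Qed.

(** What an involutive lift and an isomorphism of the bundle with its image under
    [hat] have in common. *)
Definition antiholo_lift (phi : E -> E) : Prop :=
  [/\ injective phi, continuous phi,
      forall U f, AH_holo U f -> AH_holo (phi @^-1` U) (conjc \o (f \o phi)),
      forall e, AH_proj (phi e) = torus_map tau (AH_proj e) &
      forall c e, phi (AH_scale c e) = AH_scale (conjc c) (phi e)].

Lemma pic_eq_antiholo_lift : tau_invariant tau (AH_bundle D) ->
  exists phi, antiholo_lift phi.
Proof.
move=> [phi [psi [phiK _ [cphi hphi] _ [pphi sphi]]]].
exists phi; split.
- exact: can_inj phiK.
- exact: cphi.
- by move=> U f Uf; exact: (hphi U f Uf).
- by move=> e; exact: pphi.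
- by move=> c e; have := sphi (conjc c) e; rewrite /= conjcK.
Qed.

Lemma real_lift_antiholo_lift (sigma : AH_bundle D -> AH_bundle D) :
  real_lift (torus_map tau) sigma -> antiholo_lift sigma.
Proof.
move=> [sK [cs hs] ps ss]; split=> //; first exact: inv_inj.
move=> U f Uf; apply: (hs U (conjc \o f)).
by rewrite /lb_holo /= (_ : conjc \o (conjc \o f) = f)//; apply/funext => x /=; rewrite conjcK.
Qed.

(** The coordinate [g v] of the image of the point [(v, 1)] satisfies
    [g (v + l) * conj a(l, v) = a(tau l, tau v) * g v]; so [conj g] is a nowhere zero
    holomorphic section of the bundle attached to the difference of the
    Appell-Humbert datum and its conjugate by [tau].  Hence the Hermitian forms agree,
    [g] is constant, and the functional equation reduces to that of the
    semi-characters. *)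
Lemma antiholo_lift_form (phi : E -> E) : antiholo_lift phi ->
  [/\ exists2 k : R[i], k != 0 & forall v z, phi (ptE v z) = ptE (tau v) (k * conjc z),
      forall u v, H (tau u) (tau v) = conjc (H u v) &
      {in Lam, forall l, alpha (tau l) = conjc (alpha l)}].
Proof.
move=> [phi_inj phi_cont phi_holo phi_proj phi_scale].
have [tD tZ] := tau_anti.
have ex (v : normed V) : exists z, phi (ptE v 1) = ptE (tau v) z.
  by apply: AH_fibre; rewrite phi_proj AH_proj_pi /= torus_map_pi.
pose g v := projT1 (cid (ex v)).
have gE v z : phi (ptE v z) = ptE (tau v) (g v * conjc z).
  have -> : ptE v z = AH_scale z (ptE v 1) by rewrite AH_scale_pi /= mulr1.
  by rewrite phi_scale (projT2 (cid (ex v))) AH_scale_pi /= mulrC.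
have g0 v : g v != 0.
  apply/eqP => gv0; have : ptE v 1 = ptE v 0.
    by apply: phi_inj; rewrite !gE gv0 !mul0r.
  by move=> /AH_pt_inj/eqP; rewrite oner_eq0.
have gl l v : l \in Lam -> g (v + l) * conjc (AH_factor D l v) = AH_factor D (tau l) (tau v) * g v.
  move=> Ll; apply: (@AH_pt_inj R V Lam D (tau (v + l))).
  rewrite /= -gE -[AH_factor D l v]mulr1 -AH_pt_translate// gE conjc1 mulr1.
  by rewrite tD; apply: AH_pt_translate; exact: tau_Lam.
pose G : normed V -> R[i]^o := fun v => conjc (g v).
have dG v : differentiable G v.
  have [r [U [f [r0 [oU dU] bU]]]] := AH_chart D hLam (tau v : normed V).
  have [_ dphi] := phi_holo U f (conj oU dU).
  have bv : ball (tau v : normed V) r (tau v : normed V) by exact: ballxx.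
  have : U (phi (ptE v 1)) by rewrite gE; have [] := bU _ (g v * conjc 1) bv.
  move=> /(dphi (v, 1)) d1.
  have d2 : differentiable (fun w : normed V => (w, 1 : R[i]^o)) v.
    by apply: differentiable_pair.
  have := differentiable_comp d2 d1.
  apply: near_differentiable.
  have : \forall w \near v, ball (tau v : normed V) r (tau w : normed V).
    by apply: antilinear_continuous; apply: nbhsx_ballx.
  apply: filterS => w bw /=; rewrite gE.
  by have [_ ->] := bU _ (g w * conjc 1) bw; rewrite conjc1 mulr1.
pose B u v := conjc (H (tau u) (tau v)) - H u v.
have hB : hermitian_form B.
  split=> [u v w|u c v|u v]; rewrite /B.
  - by rewrite tD !AH_formDr rmorphD /=; ring.
  - by rewrite tZ !AH_formZr rmorphM /= conjcK mulrBr.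
  - by rewrite rmorphB /= -!AH_formJ.
have G0 v : G v != 0 by rewrite /G conjc_eq0.
have Gl l v : l \in Lam -> G (v + l) * AH_factor D l v = conjc (AH_factor D (tau l) (tau v)) * G v.
  by move=> Ll; rewrite /G -rmorphM -gl// rmorphM /= conjcK.
have GB l v : l \in Lam ->
    `|G (v + l)| = `|cexp (pi%:C * (B l v + 2^-1 * B l l))| * `|G v|.
  move=> Ll; have tLl := tau_Lam Ll.
  have aE l' v' : l' \in Lam ->
      `|AH_factor D l' v'| = `|cexp (pi%:C * (H l' v' + 2^-1 * H l' l'))|.
    by move=> Ll'; rewrite /AH_factor normrM AH_char_norm// mul1r.
  pose X := pi%:C * (conjc (H (tau l) (tau v)) + 2^-1 * conjc (H (tau l) (tau l))).
  pose Y := pi%:C * (H l v + 2^-1 * H l l).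
  have HG : `|G (v + l)| * `|cexp Y| = `|cexp X| * `|G v|.
    rewrite -(aE l v Ll) -normrM Gl// normrM; congr (_ * _).
    by rewrite normcJ aE// /X -conjc_factor_exponent -conjc_cexp normcJ.
  have c0 : `|cexp Y| != 0 by rewrite normr_eq0 cexp_neq0.
  apply: (mulIf c0); rewrite HG mulrAC -[in RHS]normrM -cexpD.
  by congr (`|cexp _| * _); rewrite /X /Y /B; ring.
have [B0 Gc] := nonvanishing_section hLam hB dG G0 GB.
have Hc u v : H (tau u) (tau v) = conjc (H u v).
  apply: (can_inj (@conjcK R)); rewrite conjcK; apply/eqP; rewrite -subr_eq0.
  by apply/eqP; exact: B0.
have gc v : g v = g 0 by have := congr1 conjc (Gc v); rewrite /G !conjcK.
split=> //; first by exists (g 0) => // v z; rewrite gE gc.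
move=> l Ll; have := gl l 0 Ll; rewrite gc mulrC => /(mulIf (g0 0)).
rewrite antilinear0 /AH_factor conjcM conjc_cexp conjc_factor_exponent.
rewrite -!Hc antilinear0.
by move=> /(mulIf (cexp_neq0 _)).
Qed.

Lemma AH_scale_lift_differentiable (c : R[i]) (p : normed V * R[i]^o) :
  differentiable (fun p : normed V * R[i]^o => (p.1, c * p.2 : R[i]^o)) p.
Proof.
apply: differentiable_pair; first exact: differentiable_fst.
apply: (@differentiableZ _ _ _ (snd : normed V * R[i]^o -> R[i]^o)).
exact: differentiable_snd.
Qed.

Lemma AH_scale_continuous (c : R[i]) : continuous (AH_scale c : E -> E).
Proof.
apply/quotient_continuous.
have -> : AH_scale c \o \pi_E = \pi_E \o (fun p : normed V * R[i]^o => (p.1, c * p.2 : R[i]^o)).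
  by apply/funext => p /=; rewrite AH_scale_pi.
have cm : continuous (fun p : normed V * R[i]^o => (p.1, c * p.2 : R[i]^o)).
  by move=> p; apply: differentiable_continuous; exact: AH_scale_lift_differentiable.
by move=> p; apply: (continuous_comp (cm p)); exact: pi_continuous.
Qed.

Lemma AH_scale_holo (c : R[i]) U f : @AH_holo R V Lam D U f ->
  AH_holo ((@AH_scale R V Lam D c) @^-1` U) (f \o (@AH_scale R V Lam D c)).
Proof.
move=> [oU dU]; split.
  have /continuousP := @AH_scale_continuous c; exact.
move=> p; rewrite /= AH_scale_pi => /dU dp.
have -> : f \o @AH_scale R V Lam D c \o \pi_E =
    (f \o \pi_E) \o (fun p : normed V * R[i]^o => (p.1, c * p.2 : R[i]^o)).
  by apply/funext => q /=; rewrite AH_scale_pi.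
exact: (differentiable_comp (AH_scale_lift_differentiable c p) dp).
Qed.

(** Dividing an anti-holomorphic lift by its constant [k] gives the involution
    [[v, z] |-> [tau v, conj z]]. *)
Lemma real_lift_exists : tau_invariant tau (AH_bundle D) ->
  exists sigma, @real_lift R _ (torus_map tau) (AH_bundle D) sigma.
Proof.
move=> /pic_eq_antiholo_lift[phi hphi].
have [[k k0 phiE] Hc ac] := antiholo_lift_form hphi.
have [phi_inj phi_cont phi_holo phi_proj phi_scale] := hphi.
pose sigma : E -> E := AH_scale k^-1 \o phi.
have sE v z : sigma (ptE v z) = ptE (tau v) (conjc z).
  by rewrite /sigma /= phiE AH_scale_pi /= mulKf.
have ptP (e : E) : exists v z, e = ptE v z.
  by case: (repr e) (reprK e) => v z <-; exists v, z.
exists sigma; split.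
- by move=> e; have [v [z ->]] := ptP e; rewrite !sE tau_invol conjcK.
- split=> [|U f Uf].
    by move=> e; apply: continuous_comp; [exact: phi_cont|exact: AH_scale_continuous].
  have := phi_holo _ _ (AH_scale_holo k^-1 Uf).
  rewrite /= (_ : conjc \o _ = f \o sigma)//.
  by apply/funext => e /=; rewrite conjcK.
- by move=> e; have [v [z ->]] := ptP e; rewrite /lb_proj /= sE !AH_proj_pi /= torus_map_pi.
- move=> c e; have [v [z ->]] := ptP e.
  by rewrite /lb_scale /= AH_scale_pi !sE AH_scale_pi /= rmorphM.
Qed.

End RealStructure.

(** * Signs *)

Section Signs.
Variable R : realType.

Lemma sign_ofD (a b : 'Z_2) : sign_of R (a + b) = sign_of R a * sign_of R b.
Proof.
case: a b => [[|[|//]] ?] [[|[|//]] ?];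
  by rewrite /sign_of /= ?expr0 ?expr1 ?mulr1 ?mul1r ?mulrNN ?mulr1.
Qed.

Lemma sign_of0 : sign_of R 0 = 1. Proof. by []. Qed.

Lemma sign_of1 : sign_of R 1 = -1. Proof. by rewrite /sign_of expr1. Qed.

Lemma sign_of_inj : injective (sign_of R).
Proof.
have h : (1 : R[i]) = -1 -> False.
  by move=> /eqP; rewrite -subr_eq0 opprK -mulr2n pnatr_eq0.
move=> [[|[|//]] ?] [[|[|//]] ?]; rewrite /sign_of /= ?expr0 ?expr1 => E; apply/val_inj => //=.
  by case: (h (esym E)).
Qed.

Lemma mod2_int (k : int) : mod2 (k%:~R : R) = k%:~R.
Proof. by rewrite /mod2 intrKfloor. Qed.

Lemma cexp_pi_int (m : R) : m \is a Num.int ->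
  cexp ('i * (pi * m)%:C) = sign_of R (mod2 m).
Proof.
move=> /intrP[k ->]; rewrite mod2_int.
pose e (k : int) : R[i] := cexp ('i * (pi * k%:~R)%:C).
have e0 : e 0 = 1 by rewrite /e mulr0 rmorph0 mulr0 cexp0.
have eD a b : e (a + b) = e a * e b.
  by rewrite /e -cexpD -mulrDr -rmorphD -mulrDr -intrD.
have e1 : e 1 = -1.
  rewrite /e mulr1 mulrC mulrC -[_%:C]/(_ +i* 0) (_ : 'i * (pi +i* 0) = 0 +i* pi); last first.
    by apply/eqP; rewrite eq_complex /=; apply/andP; split; apply/eqP; ring.
  rewrite cexpE expR0 cospi sinpi mul1r.
  by apply/eqP; rewrite eq_complex /= oppr0 !eqxx.
have en (n : nat) : e n = sign_of R (n%:~R).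
  elim: n => [|n ih]; first by rewrite e0.
  by rewrite -addn1 PoszD eD ih e1 intrD sign_ofD sign_of1.
case: k => n; first exact: en.
have sN : sign_of R (Negz n)%:~R = sign_of R n.+1%:~R.
  congr sign_of; rewrite NegzE intrN.
  by apply/eqP; rewrite eq_sym -addr_eq0 -mulr2n -mulr_natr; case: (_%:~R) => [[|[|//]] ?].
have : e (Negz n) * e n.+1%:Z = 1 by rewrite -eD NegzE addNr.
rewrite sN en -/(e (Negz n)); set s := sign_of _ _ => es.
have ss : s * s = 1.
  by rewrite /s -sign_ofD -mulr2n -mulr_natr (_ : 2%:R = 0 :> 'Z_2) ?mulr0//; exact/val_inj.
by rewrite -[LHS]mulr1 -ss mulrA es mul1r.
Qed.
End Signs.


(** * The real line bundle over a loop *)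

Section RealLoop.
Variables (R : realType) (V : vectType R[i]) (Lam : zmodClosed V) (D : AH_datum Lam).
Local Notation E := (AH_total D).
Local Notation H := (AH_form D).
Local Notation alpha := (AH_char D).
Local Notation ptE v z := (\pi_E ((v : normed V), (z : R[i]^o))).

Variable tau : V -> V.
Hypotheses (hLam : maximal_lattice Lam) (tau_anti : antilinear tau).
Hypothesis Hc : forall u v, H (tau u) (tau v) = conjc (H u v).
Hypothesis ac : {in Lam, forall l, alpha (tau l) = conjc (alpha l)}.

Definition exp_ipi (x : R) : R[i] := cexp ('i * (pi * x)%:C).

Lemma exp_ipiD x y : exp_ipi (x + y) = exp_ipi x * exp_ipi y.
Proof. by rewrite /exp_ipi -cexpD -mulrDr -rmorphD -mulrDr. Qed.

Lemma exp_ipi0 : exp_ipi 0 = 1. Proof. by rewrite /exp_ipi mulr0 rmorph0 mulr0 cexp0. Qed.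

Lemma conjc_exp_ipi x : conjc (exp_ipi x) = exp_ipi (- x).
Proof.
rewrite /exp_ipi conjc_cexp; congr cexp.
by apply/eqP; rewrite eq_complex /=; apply/andP; split; apply/eqP; ring.
Qed.

Lemma exp_ipi_continuous : continuous (exp_ipi : R -> R[i]^o).
Proof.
move=> x; apply: (@continuous_comp _ _ _ (fun x : R => 'i * (pi * x)%:C : R[i]^o)
  (@cexp R : R[i]^o -> R[i]^o)).
  apply: (@continuous_comp _ _ _ (fun x : R => (pi * x)%:C : R[i]^o)
    (fun z : R[i]^o => 'i * z : R[i]^o)).
    apply: (@continuous_comp _ _ _ (fun x : R => pi * x) (fun x : R => x%:C : R[i]^o)).
      exact: mulrl_continuous.
    exact: real_complex_continuous.
  exact: (@mulrl_continuous R[i] 'i).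
by apply: differentiable_continuous; exact: differentiable_cexp.
Qed.

Lemma frame_continuous (a : R[i]) (b : R) :
  continuous (fun t : R => a * exp_ipi (t * b) : R[i]^o).
Proof.
move=> t; apply: (@continuous_comp _ _ _ (fun t : R => exp_ipi (t * b) : R[i]^o)
  (fun z : R[i]^o => a * z : R[i]^o)).
  apply: (@continuous_comp _ _ _ (fun t : R => t * b) (exp_ipi : R -> R[i]^o)).
    exact: mulrr_continuous.
  exact: exp_ipi_continuous.
exact: (@mulrl_continuous R[i] a).
Qed.

Variables (mu lam : V) (sigma : E -> E) (kappa : R[i]).
Hypotheses (hmu : half_anti Lam tau mu) (Llam : lam \in Lam) (tlam : tau lam = lam).
Hypotheses (kappa1 : `|kappa| = 1)
  (sigmaE : forall v z, sigma (ptE v z) = ptE (tau v) (kappa * conjc z)).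

Let m := complex.Im (H (mu *+ 2) lam).
Let p (t : R) : V := mu + t%:C *: lam.

Lemma tau_mu : tau mu = - mu.
Proof.
have [_ h] := hmu; have [tD _] := tau_anti.
have n2 : (2%:R : R[i]) != 0 by rewrite pnatr_eq0.
apply: (scalerI n2); rewrite !scaler_nat mulNrn -h.
by rewrite !mulr2n tD.
Qed.

(** As [tau mu = - mu] and [tau lam = lam], conjugation changes the sign of
    [H mu lam], which is thus purely imaginary. *)
Lemma H_mu_lam : H mu lam = 'i * (m / 2)%:C.
Proof.
have := Hc mu lam; rewrite tau_mu tlam -scaleN1r (herm_scalel (AH_form_herm D)).
have mE : m = 2 * complex.Im (H mu lam).
  rewrite /m mulr2n (herm_addl (AH_form_herm D)).
  by case: (H mu lam) => a b /=; ring.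
rewrite mE; case: (H mu lam) => a b /= [].
move=> E1 _; have a0 : a = 0 by lra.
by apply/eqP; rewrite eq_complex a0 /=; apply/andP; split; apply/eqP; field.
Qed.

(** [p t - mu *+ 2] is [tau (p t)]; the constant terms of the exponent,
    [- H(2 mu, mu)] and half of [H(2 mu, 2 mu)], cancel. *)
Lemma AH_factor_mu t :
  AH_factor D (mu *+ 2) (p t - mu *+ 2) = alpha (mu *+ 2) * exp_ipi (t * m).
Proof.
have hH := AH_form_herm D.
rewrite /AH_factor /exp_ipi; congr (_ * cexp _).
rewrite (herm_addr hH) (herm_oppr hH) /p (herm_addr hH) (herm_scaler hH) mulr2n.
rewrite !(herm_addl hH) !(herm_addr hH) H_mu_lam.
rewrite (herm_diag hH mu); set d := complex.Re _.
rewrite (rmorphM _ pi) (rmorphM _ t) (rmorphM _ m) /= fmorphV rmorph_nat.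
by field.
Qed.

Lemma AH_factor_lam : AH_factor D lam mu =
  alpha lam * exp_ipi (- (m / 2)) * (expR (pi / 2 * complex.Re (H lam lam)))%:C.
Proof.
have hH := AH_form_herm D.
rewrite /AH_factor /exp_ipi -mulrA; congr (_ * _).
have -> : (expR (pi / 2 * complex.Re (H lam lam)))%:C = cexp (pi / 2 * complex.Re (H lam lam))%:C.
  by rewrite /cexp /= cos0 sin0 [_ +i* 0]/(1%:C) mulr1.
rewrite -cexpD; congr cexp.
rewrite (herm_conj hH mu lam) H_mu_lam {1}(herm_diag hH lam); set d := complex.Re _.
have -> : conjc ('i * (m / 2)%:C) = - ('i * (m / 2)%:C).
  by apply/eqP; rewrite eq_complex /=; apply/andP; split; apply/eqP; ring.
rewrite (rmorphM _ pi) (rmorphM _ (pi / 2)) (rmorphM _ pi) (rmorphN _ (m / 2)).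
rewrite (rmorphM _ m) /= fmorphV rmorph_nat.
by field.
Qed.

(** The absolute value of the factor of automorphy of [lam] at [mu]. *)
Let growth := expR (pi / 2 * complex.Re (H lam lam)).
(** The fixed real line of [sigma] over [p t] is spanned by [frame t], a continuous
    choice of a square root of the multiplier of [z |-> conj z] in the fibre
    coordinate. *)
Let rho := sqrtc (alpha (mu *+ 2) * kappa).
Let frame (t : R) : R[i] := rho * exp_ipi (t * m / 2).

Lemma frame_sqr t : frame t ^+ 2 = alpha (mu *+ 2) * kappa * exp_ipi (t * m).
Proof.
rewrite /frame exprMn sqr_sqrtc; congr (_ * _).
by rewrite expr2 -exp_ipiD; congr exp_ipi; field.
Qed.

Lemma frame_conj t : frame t * conjc (frame t) = 1.
Proof.
have [L2 _] := hmu.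
rewrite /frame conjcM conjc_exp_ipi mulrACA -exp_ipiD subrr exp_ipi0 mulr1 -sqr_normc -normrX.
by rewrite sqr_sqrtc normrM kappa1 AH_char_norm// mulr1.
Qed.

Lemma sigma_loop t z : sigma (ptE (p t) z) = ptE (p t) (frame t ^+ 2 * conjc z).
Proof.
have [L2 _] := hmu; have [tD tZ] := tau_anti.
rewrite sigmaE frame_sqr.
have -> : tau (p t) = p t - mu *+ 2.
  rewrite /p tD tZ tlam tau_mu mulr2n opprD addrA [in RHS]addrAC subrr add0r addrC.
  by congr (_ + _ *: _); exact: conjc_real.
rewrite (AH_pt_translate D (p t - mu *+ 2) _ L2) AH_factor_mu subrK; congr (ptE _ _).
by rewrite mulrA (mulrAC _ (exp_ipi _)).
Qed.

(** Fixed points are the real multiples of the frame: [z / frame t], written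
    [z * conj (frame t)], is its own conjugate. *)
Lemma sigma_fixed t z : sigma (ptE (p t) z) = ptE (p t) z ->
  z = frame t * (complex.Re (z * conjc (frame t)))%:C.
Proof.
rewrite sigma_loop => /AH_pt_inj zE.
have rc := frame_conj t.
have real : conjc (z * conjc (frame t)) = z * conjc (frame t).
  rewrite -[in RHS]zE conjcM conjcK.
  have -> : frame t ^+ 2 * conjc z * conjc (frame t) =
      (frame t * conjc (frame t)) * (conjc z * frame t).
    by move: (frame t) (conjc (frame t)) (conjc z) => x y w; ring.
  by rewrite rc mul1r.
have <- : z * conjc (frame t) = (complex.Re (z * conjc (frame t)))%:C.
  move: real; case: (z * _) => a b [] /eqP; rewrite eq_sym -addr_eq0 -mulr2n mulrn_eq0 /=.
  by move=> /eqP ->.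
by rewrite mulrCA rc mulr1.
Qed.

Lemma sigma_fixed_real t (x : R) :
  sigma (ptE (p t) (frame t * x%:C)) = ptE (p t) (frame t * x%:C).
Proof.
rewrite sigma_loop conjcM conjc_real; congr (ptE _ _).
by rewrite expr2 mulrA -(mulrA (frame t)) frame_conj mulr1.
Qed.

Lemma loop_ends z0 z1 : ptE (p 0) z0 = ptE (p 1) z1 <->
  z1 = alpha lam * exp_ipi (- (m / 2)) * growth%:C * z0.
Proof.
have -> : p 0 = mu by rewrite /p scale0r addr0.
have -> : p 1 = mu + lam by rewrite /p scale1r.
rewrite (AH_pt_translate D mu z0 Llam) AH_factor_lam.
by split=> [/AH_pt_inj <-|->].
Qed.

(** [alpha lam = alpha (tau lam)] is its own conjugate, and of modulus one. *)
Lemma AH_char_real : alpha lam = 1 \/ alpha lam = -1.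
Proof.
have := ac Llam; rewrite tlam => aR.
have : alpha lam ^+ 2 = 1.
  by rewrite expr2 {2}aR -sqr_normc AH_char_norm// expr1n.
by move=> /eqP; rewrite sqrf_eq1 => /orP[] /eqP; [left|right].
Qed.
Lemma Im_form_int : m \is a Num.int.
Proof. by have [L2 _] := hmu; exact: AH_form_int. Qed.

(** The sign by which the real fibre coordinate in the frame [frame] is multiplied
    around the loop. *)
Let holonomy := alpha lam * sign_of R (mod2 m).

Lemma holonomy_pm1 : holonomy = 1 \/ holonomy = -1.
Proof.
have s1 : sign_of R (mod2 m) = 1 \/ sign_of R (mod2 m) = -1.
  case: (mod2 m) => [[|[|//]] ?]; first by left; rewrite /sign_of expr0.
  by right; rewrite /sign_of expr1.
rewrite /holonomy; case: AH_char_real => ->; case: s1 => ->;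
  rewrite ?mul1r ?mulrNN ?mulr1; by [left|right].
Qed.

Lemma holonomy_half : alpha lam * exp_ipi (- (m / 2)) = holonomy * exp_ipi (m / 2).
Proof.
rewrite /holonomy -(cexp_pi_int Im_form_int) -/(exp_ipi m) -mulrA -exp_ipiD.
have em : exp_ipi m = exp_ipi (- m).
  rewrite -conjc_exp_ipi /exp_ipi cexp_pi_int ?Im_form_int// /sign_of.
  case: (mod2 m) => [[|[|//]] ?]; first by rewrite expr0 conjc1.
  by rewrite expr1 rmorphN1.
have -> : - (m / 2) = - m + m / 2 by field.
by rewrite !exp_ipiD em.
Qed.

Lemma frame_ends : frame 1 = frame 0 * exp_ipi (m / 2).
Proof. by rewrite /frame mul0r mul0r exp_ipi0 mulr1 mul1r. Qed.

Definition loop_section (s : R -> E) : Prop :=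
  [/\ {within `[0, 1], continuous s}, s 0 = s 1 &
   forall t : R, 0 <= t <= 1 ->
     [/\ AH_proj (s t) = torus_loop Lam mu lam t, sigma (s t) = s t &
         s t <> AH_scale 0 (s t)]].

(** When the holonomy is [1], interpolate linearly between the positive coordinates
    [1] and [growth], which represent the same point. *)
Lemma loop_section_exists : holonomy = 1 -> exists s, loop_section s.
Proof.
move=> eps1.
have c0 : 0 < growth by exact: expR_gt0.
pose q (t : R) := 1 + t * (growth - 1).
exists (fun t => ptE (p t) (frame t * (q t)%:C)); split.
- apply: continuous_subspaceT => t.
  have cp : {for t, continuous (fun t : R => (p t : normed V, frame t * (q t)%:C : R[i]^o))}.
    have cpt : {for t, continuous (fun t : R => p t : normed V)} by exact: real_line_continuous.
    have cq : {for t, continuous (fun t : R => (q t)%:C : R[i]^o)}.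
      apply: (@continuous_comp _ _ _ q (fun x : R => x%:C : R[i]^o)).
        exact: (cvgD (cvg_cst _) (cvgM cvg_id (cvg_cst _))).
      exact: real_complex_continuous.
    have crt : {for t, continuous (frame : R -> R[i]^o)}.
      rewrite (_ : frame = fun t : R => rho * exp_ipi (t * (m / 2))); first exact: frame_continuous.
      by apply/funext => x; rewrite /frame mulrA.
    exact: (cvg_pair cpt (cvgM crt cq)).
  exact: (continuous_comp cp (@pi_continuous _ _ _)).
- apply/loop_ends; rewrite holonomy_half eps1 mul1r frame_ends /q mul0r addr0 mul1r.
  rewrite (_ : 1 + (growth - 1) = growth) ?mulr1; last by ring.
  by rewrite mulrC (mulrC (frame 0)) mulrA (mulrC growth%:C).
move=> t /andP[t0 t1]; split.
- by rewrite AH_proj_pi.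
- exact: sigma_fixed_real.
rewrite AH_scale_pi /= mul0r => /AH_pt_inj /eqP; rewrite mulf_eq0 => /orP[/eqP rt0|].
  by have := frame_conj t; rewrite rt0 mul0r => /esym/eqP; rewrite oner_eq0.
rewrite -(rmorph0 (real_complex R)) (inj_eq (@complexI _)) gt_eqF// /q.
have : 0 <= t * growth by rewrite mulr_ge0// ltW.
have [t1'|] := ltP t 1; first by nra.
by move=> t1' _; rewrite (_ : t = 1); lra.
Qed.

(** Read in the frame [frame], a nowhere zero section becomes a nowhere zero
    continuous real function on the unit interval, so its sign is constant, while
    its values at the ends differ by the factor [holonomy * growth]. *)
Lemma loop_section_holonomy s : loop_section s -> holonomy = 1.
Proof.
move=> [cs s01 sP]; case: holonomy_pm1 => // epsN; exfalso.
have c0 : 0 < growth by exact: expR_gt0.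
have ex (t : R) : exists z, 0 <= t <= 1 -> s t = ptE (p t) z.
  have [t01|nt] := pselect (0 <= t <= 1); last by exists 0.
  have [st _ _] := sP t t01.
  by have [z zE] := AH_fibre (st : AH_proj (s t) = \pi_(torus Lam) (p t : normed V)); exists z.
pose z (t : R) : R[i]^o := projT1 (cid (ex t)).
have zE (t : R) : 0 <= t <= 1 -> s t = ptE (p t) (z t) by exact: projT2 (cid (ex t)).
pose q (t : R) : R := complex.Re (z t * conjc (frame t)).
have zq (t : R) : 0 <= t <= 1 -> z t = frame t * (q t)%:C.
  by move=> t01; apply: sigma_fixed; rewrite -zE//; have [] := sP t t01.
have q0 (t : R) : 0 <= t <= 1 -> q t != 0.
  move=> t01; apply/eqP => qt0; have [_ _] := sP t t01; apply.
  by rewrite zE// AH_scale_pi /= mul0r zq// qt0 rmorph0 mulr0.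
have h0 : 0 <= (0 : R) <= 1 by rewrite lexx ler01.
have h1 : 0 <= (1 : R) <= 1 by rewrite lexx ler01.
have q1 : q 1 = - growth * q 0.
  have : z 1 = - (frame 1 * (growth * q 0)%:C).
    have /loop_ends -> : ptE (p 0) (z 0) = ptE (p 1) (z 1) by rewrite -!zE.
    rewrite holonomy_half epsN zq// frame_ends rmorphM mulN1r !mulNr; congr (- _).
    rewrite /=; move: (frame 0) (exp_ipi _) (growth%:C) ((q 0)%:C) => a b d e; ring.
  rewrite zq// -mulrN -rmorphN => /mulfI E; have {}E := complexI (E _).
  rewrite E ?mulNr//.
  by apply/eqP => rt0; have := frame_conj 1; rewrite rt0 mul0r => /esym/eqP; rewrite oner_eq0.
(* continuity of the fibre coordinate of [s], through the local coordinates of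
   the bundle *)
have cz (t : R) : 0 <= t <= 1 ->
    z u @[u --> within `[0, 1]%classic (nbhs t)] --> (z t : R[i]^o).
  move=> t01; have [r [U [f [r0 hf bU]]]] := AH_chart D hLam (p t : normed V).
  have bt : ball (p t : normed V) r (p t : normed V) by exact: ballxx.
  have Ust : U (s t) by rewrite zE//; have [] := bU _ (z t) bt.
  have cf := AH_holo_continuous hf Ust.
  have cst : s u @[u --> within `[0, 1]%classic (nbhs t)] --> s t.
    by move: cs => /subspace_continuousP; apply; rewrite /= in_itv.
  have fst : f (s t) = z t by rewrite zE//; have [_ ->] := bU _ (z t) bt.
  have : (f (s u) : R[i]^o) @[u --> within `[0, 1]%classic (nbhs t)] --> (z t : R[i]^o).
    by rewrite -fst; exact: (cvg_comp _ _ cst cf).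
  apply: cvg_trans; apply: near_eq_cvg; rewrite near_withinE.
  have : \forall u \near t, ball (p t : normed V) r (p u : normed V).
    by apply: (@real_line_continuous R V mu lam t); exact: nbhsx_ballx.
  apply: filterS => u bu u01; rewrite zE; last by move: u01; rewrite /= in_itv.
  by have [_ ->] := bU _ (z u) bu.
have crt : continuous (fun t : R => conjc (frame t) : R[i]^o).
  rewrite (_ : (fun t : R => _) = fun t : R => conjc rho * exp_ipi (t * - (m / 2))).
    exact: frame_continuous.
  by apply/funext => x; rewrite /frame conjcM conjc_exp_ipi; congr (_ * exp_ipi _); field.
have cq : {within `[0, 1], continuous q}.
  apply/subspace_continuousP => t /=; rewrite in_itv /= => t01.
  have czq : z u * conjc (frame u) @[u --> within `[0, 1]%classic (nbhs t)] -->
      (z t * conjc (frame t) : R[i]^o).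
    have crtw : conjc (frame u) @[u --> within `[0, 1]%classic (nbhs t)] -->
        (conjc (frame t) : R[i]^o).
      apply: cvg_within_filter; exact: crt.
    exact: (cvgM (cz t t01) crtw).
  exact: (cvg_comp _ _ czq (@Re_continuous R (z t * conjc (frame t)))).
have [t t01 qt] : exists2 t, t \in `[0, 1]%R & q t = 0.
  apply: (IVT ler01 cq); rewrite q1 ge_min le_max.
  have := q0 0 h0; rewrite neq_lt => /orP[] hq; apply/andP; split; apply/orP.
  - by left; exact: ltW.
  - by right; rewrite mulNr oppr_ge0 nmulr_lle0// ltW.
  - by right; rewrite mulNr oppr_le0 mulr_ge0// ltW.
  - by left; exact: ltW.
by move: t01; rewrite in_itv => /q0; rewrite qt eqxx.
Qed.

Lemma w1_loop_sign :
  sign_of R (@w1_loop R _ (AH_bundle D) sigma (torus_loop Lam mu lam)) = holonomy.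
Proof.
rewrite /w1_loop; case: asboolP => [[s sP]|nsec].
  by rewrite sign_of0 (@loop_section_holonomy s).
rewrite sign_of1; case: holonomy_pm1 => // /loop_section_exists[s sP].
by case: nsec; exists s.
Qed.

End RealLoop.

Theorem theorem8 (R : realType) (V : vectType R[i]) (Lam : zmodClosed V)
    (hLam : maximal_lattice Lam)
    (tau : V -> V) (tau_anti : antilinear tau) (tau_invol : involutive tau)
    (tau_Lam : {in Lam, forall l, tau l \in Lam})
    (D : AH_datum Lam) (hD : tau_invariant tau (AH_bundle D)) :
  [/\ forall mu : V, half_anti Lam tau mu ->
        forall lam : V, lam \in Lam -> tau lam = lam ->
          w_class tau (AH_bundle D) mu lam =
          w_class tau (AH_bundle D) 0 lam
            + mod2 (complex.Im (AH_form D (mu *+ 2) lam)),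
      forall lam : V, lam \in Lam ->
        forall mu : V, half_anti Lam tau mu ->
          w_class tau (AH_bundle D) mu (lam + tau lam) =
          mod2 (complex.Im (AH_form D lam (tau lam)))
    & forall lam : V, lam \in Lam -> tau lam = lam ->
        sign_of R (w_class tau (AH_bundle D) 0 lam) = (AH_char D lam)^*].
Proof.
have [tD tZ] := tau_anti.
have hH := AH_form_herm D.
have sigmaP : real_lift (torus_map tau) (chosen_lift (torus_map tau) (E := AH_bundle D)).
  rewrite /chosen_lift; case: pselect => [h|h]; first exact: projT2 (cid h).
  by case: h; exact: real_lift_exists.
set sigma := chosen_lift _ in sigmaP.
have [[k k0 sigmaE] Hc ac] :=
  antiholo_lift_form hLam tau_anti tau_Lam (real_lift_antiholo_lift sigmaP).
have k1 : `|k| = 1.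
  have [sK _ _ _] := sigmaP.
  have := sK (\pi_(AH_total D) ((0 : normed V), (1 : R[i]^o))).
  rewrite !sigmaE tau_invol => /AH_pt_inj; rewrite conjcM conjcK mulr1 -sqr_normc.
  by move=> /eqP; rewrite sqrp_eq1// => /eqP.
(* the class at any loop; the assertions only compare its instances *)
have key mu lam : half_anti Lam tau mu -> lam \in Lam -> tau lam = lam ->
    sign_of R (w_class tau (AH_bundle D) mu lam) =
    AH_char D lam * sign_of R (mod2 (complex.Im (AH_form D (mu *+ 2) lam))).
  by move=> hmu Ll tl; exact: (w1_loop_sign hLam tau_anti Hc ac hmu Ll tl k1 sigmaE).
have half0 : half_anti Lam tau 0.
  by rewrite /half_anti mul0rn rpred0 oppr0 (antilinear0 tau_anti).
have key0 lam : lam \in Lam -> tau lam = lam ->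
    sign_of R (w_class tau (AH_bundle D) 0 lam) = AH_char D lam.
  by move=> Ll tl; rewrite key// mul0rn (herm0l hH) /mod2 /= floor0 mulr1.
split.
- move=> mu hmu lam Ll tl; apply: (@sign_of_inj R).
  by rewrite sign_ofD key// key0.
- move=> lam Ll mu hmu; apply: (@sign_of_inj R).
  have tLl := tau_Lam _ Ll.
  have Lt : lam + tau lam \in Lam by rewrite rpredD.
  have tt : tau (lam + tau lam) = lam + tau lam by rewrite tD tau_invol addrC.
  have [L2 t2] := hmu.
  rewrite key// AH_charD// ac// -sqr_normc AH_char_norm// expr1n mul1r.
  rewrite cexp_pi_int ?AH_form_int//.
  rewrite -[RHS]mulr1; congr (_ * _).
  (* an even integer, because [Im H(2 mu, lam)] is an integer *)
  have -> : complex.Im (AH_form D (mu *+ 2) (lam + tau lam)) =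
      complex.Im (AH_form D (mu *+ 2) lam) *+ 2.
    have := Hc (mu *+ 2) lam; rewrite t2 -scaleN1r (herm_scalel hH) (herm_addr hH).
    case: (AH_form D _ (tau lam)) (AH_form D _ lam) => a b [a' b'] /= [_ E].
    by rewrite mulr2n; lra.
  rewrite -cexp_pi_int ?rpredMn ?AH_form_int// -/(exp_ipi _) mulr2n exp_ipiD.
  rewrite /exp_ipi cexp_pi_int ?AH_form_int// -expr2 /sign_of -exprM mulnC exprM.
  by rewrite sqrrN expr1n expr1n.
- move=> lam Ll tl; rewrite key0//.
  by rewrite -[in LHS]tl ac.
Qed.
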